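(* Let $q\in L^{1}[0,1]$ be real-valued, let $t\in[0,2\pi)$ be fixed, let $\lambda_{0}(t)$ be the first (smallest) eigenvalue of the quasi-periodic boundary value problem $L_{t}(q)$, and for $n$ large let $\lambda_n(t)$ be the eigenvalues of $L_t(q)$ labelled as described in the context. Let $n_{0}$ be a sufficiently large positive integer. Then the following two assertions hold: (a) If $t\in[0,\pi)$, $\lambda_{0}(t)\geq t^{2}$, and $\lambda_{n}(t)=(2n\pi+t)^{2}$ for all integers $n>n_{0}$, then $q=0$ almost everywhere on $[0,1]$. (b) If $t\in[\pi,2\pi)$, $\lambda_{0}(t)\geq (2\pi-t)^{2}$, and $\lambda_{n}(t)=(2n\pi+t)^{2}$ for all integers $n>n_{0}$, then $q=0$ almost everywhere on $[0,1]$.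
   Context: For a real-valued function $q\in L^{1}[0,1]$ and $t\in[0,2\pi)$, $L_{t}(q)$ denotes the self-adjoint operator in $L^{2}[0,1]$ (equivalently, the boundary value problem) generated by the differential equation $$-y''(x)+q(x)y(x)=\lambda y(x),\qquad x\in[0,1],$$ and the quasi-periodic boundary conditions $$y(1)=e^{it}y(0),\qquad y'(1)=e^{it}y'(0).$$ The cases $t=0$ and $t=\pi$ are the periodic and anti-periodic problems, respectively. The first eigenvalue $\lambda_{0}(t)$ is the smallest eigenvalue of $L_t(q)$. Labelling: the eigenvalues of $L_t(q)$, counted with multiplicity, are denoted $\{\lambda_n(t)\}_{n\in\mathbb{Z}}$. When $q=0$ the eigenvalues are $(2\pi n+t)^2$, $n\in\mathbb{Z}$, with eigenfunctions $e^{i(2\pi n+t)x}$. For general $q$, the labelling for large $|n|$ is the one matching this unperturbed spectrum, i.e. such that $\lambda_n(t)-(2\pi n+t)^2$ stays bounded as $|n|\to\infty$. For $t\neq 0,\pi$ this determines $\lambda_n(t)$ for all sufficiently large $|n|$; for $t=0$ (respectively $t=\pi$) the two eigenvalues near $(2\pi n)^2$ (respectively near $(2\pi n+\pi)^2$) are labelled by $n$ and $-n$ (respectively $n$ and $-n-1$) in either order. ''$n_0$ sufficiently large'' means only that $n_0$ is large enough for this labelling to apply to all $n>n_0$; i.e. the hypothesis is that the equality $\lambda_n(t)=(2n\pi+t)^2$ holds for all sufficiently large $n$. *)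

(* Defs.v *)
From HB Require Import structures.
From mathcomp Require Import all_boot all_order all_algebra.
From mathcomp Require Import all_classical all_reals all_analysis.
From mathcomp Require Import complex.

Set Implicit Arguments.
Unset Strict Implicit.
Unset Printing Implicit Defensive.

Import Order.TTheory GRing.Theory Num.Theory.
Import numFieldNormedType.Exports.

Local Open Scope classical_set_scope.
Local Open Scope ring_scope.
Local Open Scope complex_scope.
Local Open Scope card_scope.

(* The class L^1[0,1]; a.e. classes are represented by Borel functions on R
   whose values outside [0,1] are irrelevant. *)
Definition L1_01 (R : realType) (q : R -> R) : Prop :=
  (@lebesgue_measure R).-integrable `[0, 1] (EFin \o q).

(* f is absolutely continuous on [0,1] with a.e. derivative g, in the sense
   that f is an indefinite Lebesgue integral of g. When g is continuous on
   [0,1], it is the classical derivative of f there (one-sided at the ends). *)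
Definition AC_deriv (R : realType) (f g : R -> R) : Prop :=
  L1_01 g /\
  forall x : R, x \in `[0, 1] ->
    f x = f 0 + \int[@lebesgue_measure R]_(s in `[0, x]) g s.

Definition AC_derivC (R : realType) (f g : R -> R[i]) : Prop :=
  AC_deriv (fun x => complex.Re (f x)) (fun x => complex.Re (g x)) /\
  AC_deriv (fun x => complex.Im (f x)) (fun x => complex.Im (g x)).

Definition expi (R : realType) (t : R) : R[i] := cos t +i* sin t.

(* The solutions of  - y'' + q y = mu y  on [0,1] (a.e., with y and y'
   absolutely continuous) such that  y(1) = e^{it} y(0)  and
   y'(1) = e^{it} y'(0);  y1 and y2 stand for y' and y''. Since L_t(q) is
   self-adjoint, only real mu have to be considered. *)
Definition eigenspace_L (R : realType) (q : R -> R) (t mu : R)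
    : set (R -> R[i]) :=
  [set y | exists y1 y2 : R -> R[i],
    [/\ AC_derivC y y1,
        AC_derivC y1 y2,
        {ae @lebesgue_measure R, forall x, x \in `[0, 1] ->
           - y2 x + (q x)%:C * y x = mu%:C * y x},
        y 1 = expi t * y 0
      & y1 1 = expi t * y1 0]].

Definition eigenvalue_L (R : realType) (q : R -> R) (t mu : R) : Prop :=
  exists2 y, eigenspace_L q t mu y & exists2 x, x \in `[0, 1] & y x != 0.

Definition first_eigenvalue_L (R : realType) (q : R -> R) (t mu : R) : Prop :=
  eigenvalue_L q t mu /\ forall nu, eigenvalue_L q t nu -> mu <= nu.

(* V has a basis of d elements over R[i], functions being identified when they
   agree on [0,1]. *)
Definition has_dim01 (R : realType) (V : set (R -> R[i])) (d : nat) : Prop :=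
  exists e : 'I_d -> R -> R[i],
    [/\ forall k, V (e k),
        forall c : 'I_d -> R[i],
          (forall x, x \in `[0, 1] -> \sum_(k < d) c k * e k x = 0) ->
          forall k, c k = 0
      & forall y, V y -> exists c : 'I_d -> R[i],
          forall x, x \in `[0, 1] -> y x = \sum_(k < d) c k * e k x].

(* lambda enumerates the eigenvalues counted with multiplicity: every mu is
   attained exactly as many times as the dimension of its eigenspace (0 times
   when mu is not an eigenvalue; geometric and algebraic multiplicities agree
   by self-adjointness). The last clause matches lambda, for large |n|, with
   the spectrum (2 pi n + t)^2 of the case q = 0. *)
Definition eigenvalue_labelling (R : realType) (q : R -> R) (t : R)
    (lambda : int -> R) : Prop :=
  (forall mu : R, exists2 d : nat,
     has_dim01 (eigenspace_L q t mu) d & [set n | lambda n = mu] #= `I_d) /\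
  (exists C : R, forall n : int,
     `|lambda n - (2 * pi * n%:~R + t) ^+ 2| <= C).

(* Main.v *)
Require Import Defs.
From HB Require Import structures.
From mathcomp Require Import all_boot all_order all_algebra.
From mathcomp Require Import all_classical all_reals all_analysis.
From mathcomp Require Import measurable_realfun complex ring lra.

(** Both assertions rest on one quadratic form.  Take a real s with
cos s = cos t, namely s = t in the first case and s = 2 pi - t in the second.
For a real function g with g 0 = g 1, the function u = g exp(i s x) or its
conjugate satisfies y(1) = exp(it) y(0), and
  int (|u'|^2 + (q - s^2) |u|^2) = int (g'^2 + q g^2).
If the spectrum lies in [s^2, +oo), the variational principle makes the
right-hand side nonnegative for every such g ([twisted_form_ge0]).  If moreover
int q = 0, then g = 1 makes it vanish, so g = 1 is a minimizer; the
perturbations g = 1 + e w then force q = 0 ([mean_zero_rigidity]).  So it is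
enough to show int q = 0, and this comes from the prescribed large eigenvalues
([mean_eq0]).

The variational principle is obtained from the initial value problem and needs
no Hilbert space.  Let phi and psi be the solutions of - y'' + q y = l y with
phi(0) = psi'(0) = 1 and phi'(0) = psi(0) = 0, and let D(l) = phi(1) + psi'(1)
be the discriminant.  If psi > 0 on (0, 1], a positive solution h exists on
[0, 1], and Jacobi's identity
  v'^2 + (q - l) v^2 - (h' v^2 / h)' = (v' - h' v / h)^2
shows that the form at l is nonnegative on functions that vanish at 0 and 1.
Splitting off a solution with the right boundary values gives
  form at l of g exp(i s x) >= g(0)^2 (D(l) - 2 cos s) / psi(1)
([twisted_energy_lower_bound]).  It remains to see that psi > 0 and
D(l) >= 2 cos s for every l below the spectrum ([below_spectrum]).  Both hold
for l very negative ([low_energy]).  As l increases, D cannot cross 2 cos t,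
because D(l) = 2 cos t makes l an eigenvalue ([discriminant_eigenvalue]); and
psi cannot lose its positivity while D > -2, because at the first loss
psi(1) = 0 and psi'(1) < 0, whence D(l) = psi'(1) + 1/psi'(1) <= -2
([ge0_positive_inside]).

For int q = 0, let k^2 be an eigenvalue with k = 2 pi n + t large, and write an
eigenfunction as y = a(x) exp(ikx) + b(x) exp(-ikx) by variation of constants.
The amplitudes move by O(1/k) only, and the boundary condition says that a
returns to its value while b is multiplied by exp(2it).  Averaging the equation
for a gives a int q = - b int q exp(-2ikx) + O(1/k), and the integral on the
right tends to 0 by the Riemann-Lebesgue lemma.  If sin t = 0 the same relation
holds with a and b exchanged, and otherwise b = O(1/k).  In all cases
|int q| is bounded by the Fourier coefficients of q of frequency 2k plus O(1/k)
([mean_bound]).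

Functions whose derivative is only integrable enter through [AC_deriv] and its
product rule [ACM]; all integrals are evaluated as increments of such
functions. *)

Set Implicit Arguments.
Unset Strict Implicit.
Unset Printing Implicit Defensive.

Import Order.TTheory GRing.Theory Num.Theory.
Import numFieldNormedType.Exports.

Local Open Scope classical_set_scope.
Local Open Scope ring_scope.

(** * Absolutely continuous functions on [0,1] *)

Section AC.
Context {R : realType}.
Notation mu := (@lebesgue_measure R).
Implicit Types f g h : R -> R.

Lemma zero_in01 : (0 : R) \in `[0, 1].
Proof. by rewrite in_itv/= lexx ler01. Qed.

Lemma one_in01 : (1 : R) \in `[0, 1].
Proof. by rewrite in_itv/= lexx ler01. Qed.

Definition cont01 f : Prop := {within `[0, 1], continuous f}.

Lemma cont01_ext f g : {in `[0, 1], f =1 g} -> cont01 f -> cont01 g.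
Proof.
move=> fg cf; apply: (@subspace_eq_continuous _ _ _ f g) => // x.
by rewrite inE; exact: fg.
Qed.

Lemma cont01_cst c : cont01 (fun=> c).
Proof. by move=> x; exact: cst_continuous. Qed.

Lemma cont01D f g : cont01 f -> cont01 g -> cont01 (fun x => f x + g x).
Proof. by move=> cf cg x; apply: continuousD; [exact: cf|exact: cg]. Qed.

Lemma cont01M f g : cont01 f -> cont01 g -> cont01 (fun x => f x * g x).
Proof. by move=> cf cg x; apply: continuousM; [exact: cf|exact: cg]. Qed.

Lemma cont01_continuous f : continuous f -> cont01 f.
Proof. exact: continuous_subspaceT. Qed.

Lemma L1_sub g a b : L1_01 g -> 0 <= a -> b <= 1 ->
  mu.-integrable `[a, b] (EFin \o g).
Proof.
move=> Lg a0 b1; apply: (integrableS _ _ _ Lg) => //.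
by move=> x /=; rewrite !in_itv/= => /andP[ax xb]; lra.
Qed.

Lemma cont01_L1 g : cont01 g -> L1_01 g.
Proof. by move=> cg; apply: continuous_compact_integrable => //; exact: segment_compact. Qed.

Lemma cont01_measurable g : cont01 g -> measurable_fun (`[0, 1] : set R) g.
Proof. by move=> cg; apply: subspace_continuous_measurable_fun. Qed.

Lemma cont01_bounded g : cont01 g ->
  exists2 M, 0 <= M & forall x, x \in `[0, 1] -> `|g x| <= M.
Proof.
move=> cg; have c : cont01 (fun x => `|g x|).
  by move=> x; apply: continuous_comp; [exact: cg|exact: norm_continuous].
have [c0 _ H] := EVT_max ler01 c.
by exists `|g c0|.
Qed.

Lemma L1_ext f g : {in `[0, 1], f =1 g} -> L1_01 f -> L1_01 g.
Proof.
move=> fg; apply: eq_integrable => // x xI /=; rewrite fg //.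
by move: xI; rewrite inE.
Qed.

Lemma L1D f g : L1_01 f -> L1_01 g -> L1_01 (fun x => f x + g x).
Proof. by move=> Lf Lg; apply: eq_integrable (integrableD _ Lf Lg). Qed.

Lemma L1Z k f : L1_01 f -> L1_01 (fun x => k * f x).
Proof. by move=> Lf; apply: eq_integrable (integrableZl _ k Lf). Qed.

Lemma L1_norm f : L1_01 f -> L1_01 (fun x => `|f x|).
Proof. exact: integrable_norm. Qed.

Lemma L1M f g : L1_01 f -> cont01 g -> L1_01 (fun x => f x * g x).
Proof.
move=> Lf cg; have [M M0 Mg] := cont01_bounded cg.
apply: eq_integrable (integrableMl _ Lf (cont01_measurable cg) _) => //.
exists M; split; first exact: num_real.
by move=> z Mz x /= xI; rewrite (le_trans (Mg x xI)) ?ltW.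
Qed.

Definition prim g x : R := \int[mu]_(s in `[0, x]) g s.

Lemma prim0 g : prim g 0 = 0.
Proof. by rewrite /prim set_itv1 Rintegral_set1. Qed.

Lemma AC_prim g : L1_01 g -> AC_deriv (prim g) g.
Proof. by move=> Lg; split=> // x _; rewrite prim0 add0r. Qed.

Lemma AC_cont f g : AC_deriv f g -> cont01 f.
Proof.
move=> [Lg fE].
have cp : cont01 (prim g).
  exact: (@parameterized_integral_continuous R 0 1 g ler01 Lg).
apply: (@cont01_ext (fun x => f 0 + prim g x)); first by move=> x /fE ->.
by apply: cont01D => //; exact: cont01_cst.
Qed.

Lemma AC_L1 f g : AC_deriv f g -> L1_01 f.
Proof. by move/AC_cont/cont01_L1. Qed.

Lemma AC_incr f g a b : AC_deriv f g -> 0 <= a -> a <= b -> b <= 1 ->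
  f b - f a = \int[mu]_(s in `[a, b]) g s.
Proof.
move=> [Lg fE] a0 ab b1.
rewrite (fE b) ?in_itv/= ?b1 ?(le_trans a0)// (fE a) ?in_itv/= ?a0 ?(le_trans ab)//.
rewrite [X in X - _]addrC addrKA (@Rintegral_itvB _ g (BLeft 0) (BRight b) a) ?bnd_simp//; last first.
  exact: L1_sub.
rewrite Rintegral_itv_obnd_cbnd//.
apply: (integrableS _ _ _ Lg) => //.
by move=> x /=; rewrite !in_itv/= => /andP[ax xb]; lra.
Qed.

Lemma AC_ext f f' g g' : AC_deriv f g -> {in `[0, 1], f =1 f'} -> L1_01 g' ->
  {ae mu, forall x, x \in `[0, 1] -> g x = g' x} -> AC_deriv f' g'.
Proof.
move=> [Lg fE] ff' Lg' gg'; split=> // x xI.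
have zero_in01 : (0 : R) \in `[0, 1] by rewrite in_itv/= lexx ler01.
rewrite -!ff'// fE//; congr (_ + fine _).
have sub : `[0, x] `<=` `[0, (1:R)].
  by move=> y /=; move: xI; rewrite !in_itv/=; lra.
apply: ae_eq_integral => //.
- by apply: measurable_int; apply: (integrableS _ _ _ Lg).
- by apply: measurable_int; apply: (integrableS _ _ _ Lg').
- by apply: (@filterS _ _ (ae_filter_ringOfSetsType mu) _ _ _ gg') => s gs /= sI; rewrite gs//; exact: sub.
Qed.

Lemma eq_AC f f' g g' : {in `[0, 1], f =1 f'} -> {in `[0, 1], g =1 g'} ->
  AC_deriv f g -> AC_deriv f' g'.
Proof.
move=> ff' gg' fg; apply: (AC_ext fg) => //.
  by apply: (L1_ext gg'); case: fg.
by apply: aeW => x /gg'.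
Qed.

Lemma AC_cst c : AC_deriv (fun=> c) (fun=> 0 : R).
Proof.
split; first by apply: cont01_L1; apply: continuous_subspaceT => x; exact: cst_continuous.
by move=> x _; rewrite /Rintegral integral0 addr0.
Qed.

Lemma ACD f f' g g' : AC_deriv f f' -> AC_deriv g g' ->
  AC_deriv (fun x => f x + g x) (fun x => f' x + g' x).
Proof.
move=> [Lf fE] [Lg gE]; split; first exact: L1D.
move=> x xI; have [x0 x1] : 0 <= x /\ x <= 1 by move: xI; rewrite in_itv/= => /andP.
rewrite fE// gE// RintegralD//; [ring|exact: L1_sub|exact: L1_sub].
Qed.

Lemma ACZ k f f' : AC_deriv f f' -> AC_deriv (fun x => k * f x) (fun x => k * f' x).
Proof.
move=> [Lf fE]; split; first exact: L1Z.
move=> x xI; have [x0 x1] : 0 <= x /\ x <= 1 by move: xI; rewrite in_itv/= => /andP.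
rewrite fE// RintegralZl//; [ring|exact: L1_sub].
Qed.

Lemma ACB f f' g g' : AC_deriv f f' -> AC_deriv g g' ->
  AC_deriv (fun x => f x - g x) (fun x => f' x - g' x).
Proof.
move=> ff gg; apply: eq_AC (ACD ff (ACZ (-1) gg)) => x _; ring.
Qed.

Lemma AC_le f f' a b : AC_deriv f f' -> 0 <= a -> a <= b -> b <= 1 ->
  (forall x, a <= x <= b -> 0 <= f' x) -> f a <= f b.
Proof.
move=> ff a0 ab b1 f0; rewrite -subr_ge0 (AC_incr ff)//.
by apply: Rintegral_ge0 => x /=; rewrite in_itv; exact: f0.
Qed.

Lemma AC_norm_le f f' g g' a b : AC_deriv f f' -> AC_deriv g g' ->
  0 <= a -> a <= b -> b <= 1 ->
  (forall x, a <= x <= b -> `|f' x| <= g' x) -> `|f b - f a| <= g b - g a.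
Proof.
move=> ff gg a0 ab b1 fg.
have H1 : f a + g a <= f b + g b.
  apply: (AC_le (ACD ff gg)) => // x xab.
  by have := fg x xab; rewrite ler_norml; lra.
have H2 : g a - f a <= g b - f b.
  apply: (AC_le (ACB gg ff)) => // x xab.
  by have := fg x xab; rewrite ler_norml; lra.
by rewrite ler_norml; apply/andP; split; lra.
Qed.


Lemma eq0_of_le_div_nat (d K : R) : (forall n, `|d| <= K / n.+1%:R) -> d = 0.
Proof.
move=> H; apply/eqP; rewrite -normr_eq0 eq_le normr_ge0 andbT leNgt.
apply/negP => d0; have K0 : 0 <= K.
  by have := H 0%N; rewrite divr1; apply: le_trans.
have := archi_boundP (divr_ge0 K0 (ltW d0)); set n := Num.bound _ => nK.
have := H n; rewrite ler_pdivlMr ?ltr0n// leNgt => /negP; apply.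
rewrite ltr_pdivrMr// in nK; apply: lt_le_trans nK _.
by rewrite mulrC ler_wpM2l// ler_nat.
Qed.

(** Cut [0, b] at points where W takes equally spaced values: each of the n
increments of D is at most C ((W b - W 0) / n)^2, so that they add up to
O(1 / n).  This replaces Fubini's theorem in the product and quotient rules,
where the defect of the claimed formula is quadratic in the variation. *)
Lemma quadratic_modulus_cst (D W : R -> R) (C b : R) : 0 <= b ->
  {within `[0, b], continuous W} ->
  (forall x y, x \in `[0, b] -> y \in `[0, b] -> x <= y ->
    `|D y - D x| <= C * (W y - W x) ^+ 2) ->
  D b = D 0.
Proof.
move=> b0 cW H.
have {}H x y : x \in `[0, b] -> y \in `[0, b] ->
    `|D y - D x| <= C * (W y - W x) ^+ 2.
  move=> xI yI; have [xy|/ltW yx] := leP x y; first exact: H.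
  by rewrite distrC -sqrrN opprB; exact: H.
have zero_in01 : 0 \in `[0, b] by rewrite in_itv/= lexx.
have Ib : b \in `[0, b] by rewrite in_itv/= lexx b0.
apply/eqP; rewrite -subr_eq0; apply/eqP.
apply: (@eq0_of_le_div_nat _ (C * (W b - W 0) ^+ 2)) => n.
pose v j : R := W 0 + j%:R / n.+1%:R * (W b - W 0).
have n0 : 0 < n.+1%:R :> R by rewrite ltr0n.
have xP j : exists x, (j <= n.+1)%N -> x \in `[0, b] /\ W x = v j.
  have [jn|] := leqP j n.+1; last by exists 0.
  have r01 : 0 <= (j%:R : R) / n.+1%:R <= 1.
    by apply/andP; split; [exact: divr_ge0|rewrite ler_pdivrMr// mul1r ler_nat].
  have [|x xI xv] := @IVT R W 0 b (v j) b0 cW; last by exists x.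
  rewrite ge_min le_max /v; move: r01; set r := _ / _ => /andP[r0 r1].
  have [Wb|Wb] := leP (W 0) (W b).
    by apply/andP; split; apply/orP; [left|right]; nra.
  by apply/andP; split; apply/orP; [right|left]; nra.
have [x {}xP] := choice xP.
(* Every increment sees one n-th of the variation of W. *)
have step j : (j < n.+1)%N ->
    `|D (x j.+1) - D (x j)| <= C * ((W b - W 0) / n.+1%:R) ^+ 2.
  move=> jn; have [x1 v1] := xP _ jn; have [x2 v2] := xP _ (ltnW jn).
  apply: le_trans (H _ _ x2 x1) _; rewrite v1 v2 /v.
  rewrite le_eqVlt; apply/orP; left; apply/eqP.
  by rewrite -[in j.+1%:R]addn1 natrD; congr (_ * _ ^+ 2); field; rewrite gt_eqF.
have E0 : D (x 0%N) = D 0.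
  have [xI xv] := xP 0%N (leq0n _).
  have := H _ _ zero_in01 xI; rewrite xv /v mul0r mul0r addr0 subrr expr0n/= mulr0.
  by rewrite normr_le0 subr_eq0 => /eqP.
have En : D (x n.+1) = D b.
  have [xI xv] := xP n.+1 (leqnn _).
  have := H _ _ Ib xI; rewrite xv /v divff ?gt_eqF// mul1r.
  rewrite (_ : W 0 + _ - W b = 0) ?expr0n/= ?mulr0; last by ring.
  by rewrite normr_le0 subr_eq0 => /eqP.
rewrite -En -E0 -(telescope_sumr (fun j => D (x j))) // big_mkord.
apply: le_trans (ler_norm_sum _ _ _) _.
apply: (@le_trans _ _ (\sum_(i < n.+1) C * ((W b - W 0) / n.+1%:R) ^+ 2)).
  by apply: ler_sum => i _; exact: step.
rewrite sumr_const card_ord -mulr_natl le_eqVlt; apply/orP; left; apply/eqP.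
by field; rewrite gt_eqF.
Qed.

Lemma L1_AC_mul f f' g g' : AC_deriv f f' -> AC_deriv g g' ->
  L1_01 (fun x => f' x * g x + f x * g' x).
Proof.
move=> ff gg; apply: L1D; first exact: L1M ff.1 (AC_cont gg).
by apply: L1_ext (L1M gg.1 (AC_cont ff)) => x _; rewrite mulrC.
Qed.

(** The defect D = f g - int (f' g + f g') over [x, y] is the integral of
f' (g y - g) + (f x - f) g', hence at most twice the product of the variations
of f and g on [x, y]. *)
Lemma ACM f f' g g' : AC_deriv f f' -> AC_deriv g g' ->
  AC_deriv (fun x => f x * g x) (fun x => f' x * g x + f x * g' x).
Proof.
move=> ff gg; have Lh := L1_AC_mul ff gg; set h := (fun x => _) in Lh *.
split=> // b bI; have [b0 b1] : 0 <= b /\ b <= 1.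
  by move: bI; rewrite in_itv/= => /andP.
pose F := prim (fun x => `|f' x|); pose G := prim (fun x => `|g' x|).
have aF := AC_prim (L1_norm ff.1); have aG := AC_prim (L1_norm gg.1).
rewrite -/F -/G in aF aG.
suff : f b * g b - prim h b = f 0 * g 0 - prim h 0.
  by rewrite prim0 /prim; lra.
apply: (@quadratic_modulus_cst (fun x => f x * g x - prim h x)
  (fun x => F x + G x) 1 b b0).
  have : cont01 (fun x => F x + G x) by exact: AC_cont (ACD aF aG).
  apply: continuous_subspaceW => x /=; rewrite !in_itv/=; lra.
move=> x y; rewrite !in_itv/= => /andP[x0 xb] /andP[y0 yb] xy.
have y1 : y <= 1 by lra.
have Fle s t : x <= s -> s <= t -> t <= y -> `|f t - f s| <= F t - F s.
  by move=> *; apply: (AC_norm_le ff aF) => //; lra.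
have Gle s t : x <= s -> s <= t -> t <= y -> `|g t - g s| <= G t - G s.
  by move=> *; apply: (AC_norm_le gg aG) => //; lra.
pose H s := g y * f s + f x * g s - prim h s.
have aH : AC_deriv H (fun s => g y * f' s + f x * g' s - h s).
  by apply: ACB (AC_prim Lh); apply: ACD; exact: ACZ.
have aK := ACD (ACZ (G y - G x) aF) (ACZ (F y - F x) aG).
have := AC_norm_le aH aK x0 xy y1 => /(_ _)/le_trans H1.
rewrite (_ : _ - _ = H y - H x); last by rewrite /H; ring.
apply: H1 => [s /andP[xs sy]|]; last first.
  have := Fle _ _ (lexx x) xy (lexx y); have := Gle _ _ (lexx x) xy (lexx y).
  have := normr_ge0 (f y - f x); have := normr_ge0 (g y - g x); nra.
rewrite (_ : _ - _ = f' s * (g y - g s) - (f s - f x) * g' s); last by rewrite /h; ring.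
apply: le_trans (ler_normB _ _) _; rewrite !normrM.
have := Fle _ _ (lexx x) xs sy; have := Gle _ _ xs sy (lexx y).
have := Fle _ _ xs sy (lexx y); have := Gle _ _ (lexx x) xs sy.
have := normr_ge0 (f y - f s); have := normr_ge0 (g s - g x).
have := normr_ge0 (f' s); have := normr_ge0 (g' s).
move=> ? ? ? ? ? ? ? ?; nra.
Qed.

Lemma AC_C1 f f' : (forall x, is_derive x (1:R) f (f' x)) -> continuous f' ->
  AC_deriv f f'.
Proof.
move=> df cf'; split; first exact/cont01_L1/cont01_continuous.
move=> x; rewrite in_itv/= => /andP[x0 x1].
have [->|xn0] := eqVneq x 0; first by rewrite set_itv1 Rintegral_set1 addr0.
have xp : 0 < x by rewrite lt_neqAle eq_sym xn0.
have cf y : {for y, continuous f}.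
  by apply: differentiable_continuous; apply/derivable1_diffP; have [] := df y.
rewrite /Rintegral (@continuous_FTC2 R f' f 0 x xp)/=.
- by lra.
- exact: continuous_subspaceT.
- split => [y _||]; [by have [] := df y| |].
    by apply: cvg_at_right_filter; exact: cf.
  by apply: cvg_at_left_filter; exact: cf.
- by move=> y _; rewrite derive1E; have [_ ->] := df y.
Qed.

End AC.

Section ACFunctions.
Context {R : realType}.
Implicit Types f g h : R -> R.

Lemma AC_deriv0_cst f g x : AC_deriv f g -> (forall x, x \in `[0, 1] -> g x = 0) ->
  x \in `[0, 1] -> f x = f 0.
Proof.
move=> [_ fE] f0 xI; rewrite fE// (@eq_Rintegral _ _ _ _ _ (fun=> 0)).
  by rewrite /Rintegral integral0 addr0.
move=> s; rewrite inE /= => sI; apply: f0.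
by move: xI sI; rewrite !in_itv/=; lra.
Qed.

Lemma AC_eq_incr f g h a b : AC_deriv f h -> AC_deriv g h ->
  a \in `[0, 1] -> b \in `[0, 1] -> f b - f a = g b - g a.
Proof.
move=> F G aI bI; have D := ACB F G.
have D0 x : x \in `[0, 1] -> h x - h x = 0 by rewrite subrr.
have := AC_deriv0_cst D D0 aI; have := AC_deriv0_cst D D0 bI; lra.
Qed.

Lemma AC_id : AC_deriv (fun x : R => x) (fun=> 1).
Proof. by apply: AC_C1 => x; exact: cst_continuous. Qed.

Lemma AC_expR (A k : R) :
  AC_deriv (fun x => A * expR (k * x)) (fun x => A * (k * expR (k * x))).
Proof.
apply: ACZ; apply: AC_C1 => [x|x].
  have d : is_derive x (1:R) (fun y => k * y) (k *: 1).
    by apply: is_deriveZ.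
  rewrite (_ : k * _ = expR (k * x) *: (k *: 1)); last first.
    by rewrite /GRing.scale/= mulr1 mulrC.
  exact: (is_derive1_comp).
apply: cvgM; first exact: cvg_cst.
apply: (@continuous_comp _ _ _ (fun y => k * y)); last exact: continuous_expR.
by apply: cvgM; [exact: cvg_cst|exact: cvg_id].
Qed.

Lemma AC_cos (k : R) : AC_deriv (fun x => cos (k * x)) (fun x => - (k * sin (k * x))).
Proof.
have dk x : is_derive x (1:R) (fun z : R => k * z) (k *: 1) by apply: is_deriveZ.
apply: AC_C1 => [x|x].
  rewrite (_ : - _ = - sin (k * x) *: (k *: 1)); last first.
    by rewrite /GRing.scale/= mulr1 mulNr mulrC.
  exact: is_derive1_comp.
apply: cvgN; apply: cvgM; first exact: cvg_cst.
apply: (@continuous_comp _ _ _ (fun z : R => k * z)); last exact: continuous_sin.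
by apply: cvgM; [exact: cvg_cst|exact: cvg_id].
Qed.

Lemma AC_sin (k : R) : AC_deriv (fun x => sin (k * x)) (fun x => k * cos (k * x)).
Proof.
have dk x : is_derive x (1:R) (fun z : R => k * z) (k *: 1) by apply: is_deriveZ.
apply: AC_C1 => [x|x].
  rewrite (_ : _ * _ = cos (k * x) *: (k *: 1)); last first.
    by rewrite /GRing.scale/= mulr1 mulrC.
  exact: is_derive1_comp.
apply: cvgM; first exact: cvg_cst.
apply: (@continuous_comp _ _ _ (fun z : R => k * z)); last exact: continuous_cos.
by apply: cvgM; [exact: cvg_cst|exact: cvg_id].
Qed.

Lemma cont01_gt0_lower h : cont01 h -> (forall x, x \in `[0, 1] -> 0 < h x) ->
  exists2 m, 0 < m & forall x, x \in `[0, 1] -> m <= h x.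
Proof.
move=> ch h0; have [c cI H] := EVT_min ler01 ch.
by exists (h c); [exact: h0|].
Qed.

(** As for the product rule, the defect 1/h + int h'/h^2 has increments bounded
by the square of the variation of h. *)
Lemma AC_inv h h' : AC_deriv h h' -> (forall x, x \in `[0, 1] -> 0 < h x) ->
  AC_deriv (fun x => (h x)^-1) (fun x => - (h' x / h x ^+ 2)).
Proof.
move=> hh h0; have ch := AC_cont hh.
have [m m0 hm] := cont01_gt0_lower ch h0.
have [M M0 hM] := cont01_bounded ch.
have ci : cont01 (fun x => (h x)^-1).
  pose k x : R := if x \in `[0, 1] then h x else 1.
  have kE : {in `[0, 1], h =1 k} by move=> x xI; rewrite /k xI.
  have k0 x : k x != 0 by rewrite /k; case: ifPn => [/h0/gt_eqF->|_] //; exact: oner_neq0.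
  apply: (@cont01_ext _ (fun x => (k x)^-1)) => [x xI|x]; first by rewrite kE.
  by apply: continuousV; [exact: k0|exact: cont01_ext kE ch x].
have L1' : L1_01 (fun x => h' x / h x ^+ 2).
  apply: L1_ext (L1M (L1M hh.1 ci) ci) => x _.
  by rewrite expr2 invfM mulrA.
have aG := AC_prim L1'; set G := prim _ in aG.
split=> [|b bI]; first by apply: L1_ext (L1Z (-1) L1') => x _; rewrite mulN1r.
have [b0 b1] : 0 <= b /\ b <= 1 by move: bI; rewrite in_itv/= => /andP.
have aV := AC_prim (L1_norm hh.1); set V := prim _ in aV.
suff : (h b)^-1 + G b = (h 0)^-1 + G 0.
  rewrite [G 0]prim0 addr0 => <-.
  suff -> : \int[lebesgue_measure]_(s in `[0, b]) - (h' s / h s ^+ 2) = - G b by ring.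
  rewrite -[RHS]mulN1r -RintegralZl//; last exact: L1_sub.
  by apply: eq_Rintegral => x _; rewrite mulN1r.
apply: (@quadratic_modulus_cst _ (fun x => (h x)^-1 + G x) V (2 * M / m ^+ 4) b b0).
  have := AC_cont aV; apply: continuous_subspaceW => x /=; rewrite !in_itv/=; lra.
move=> x y; rewrite !in_itv/= => /andP[x0 xb] /andP[y0 yb] xy.
have y1 : y <= 1 by lra.
have Vle s t : x <= s -> s <= t -> t <= y -> `|h t - h s| <= V t - V s.
  by move=> *; apply: (AC_norm_le hh aV) => //; lra.
have hx0 : m <= h x by apply: hm; rewrite in_itv/=; lra.
have hy0 : m <= h y by apply: hm; rewrite in_itv/=; lra.
pose H s := G s - (h x * h y)^-1 * h s.
have aH := ACB aG (ACZ (h x * h y)^-1 hh).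
have aK := ACZ (2 * M * (V y - V x) / m ^+ 4) aV.
have := AC_norm_le aH aK x0 xy y1 => /(_ _)/le_trans H1.
rewrite (_ : _ - _ = G y - (h x * h y)^-1 * h y - (G x - (h x * h y)^-1 * h x)); last first.
  by field; rewrite !gt_eqF//; lra.
apply: H1 => [s /andP[xs sy]|]; last by rewrite le_eqVlt; apply/orP; left; apply/eqP; ring.
have hs0 : m <= h s by apply: hm; rewrite in_itv/=; lra.
rewrite (_ : _ - _ = ((h s * (h x - h s) + h x * (h y - h s)) * h' s / (h s ^+ 2 * h x * h y))); last first.
  by field; rewrite !gt_eqF//; lra.
have sM : `|h s| <= M by apply: hM; rewrite in_itv/=; lra.
have xM : `|h x| <= M by apply: hM; rewrite in_itv/=; lra.
have Dp : m ^+ 4 <= h s ^+ 2 * h x * h y.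
  rewrite (_ : m ^+ 4 = m ^+ 2 * m * m); last by ring.
  have hs2 : m ^+ 2 <= h s ^+ 2 by rewrite lerXn2r// nnegrE; lra.
  have hsx : m ^+ 2 * m <= h s ^+ 2 * h x by apply: ler_pM; rewrite ?sqr_ge0//; lra.
  by apply: ler_pM => //; rewrite ?mulr_ge0 ?sqr_ge0 ?ltW.
have m4 : 0 < m ^+ 4 by rewrite exprn_gt0.
rewrite normrM normfV [`|_ * h x * h y|]gtr0_norm ?(lt_le_trans m4)//.
rewrite ler_pdivrMr ?(lt_le_trans m4)// normrM.
have V0 : 0 <= V y - V x by apply: le_trans (Vle _ _ (lexx x) xy (lexx y)).
apply: (@le_trans _ _ (2 * M * (V y - V x) / m ^+ 4 * `|h' s| * m ^+ 4)); last first.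
  by rewrite ler_wpM2l// !mulr_ge0// invr_ge0 ltW.
rewrite (_ : _ * m ^+ 4 = 2 * M * (V y - V x) * `|h' s|); last by field; rewrite gt_eqF.
rewrite ler_wpM2r// (le_trans (ler_normD _ _))// !normrM.
have := Vle _ _ (lexx x) xs sy; have := Vle _ _ xs sy (lexx y).
have := Vle _ _ xs (lexx s) sy; rewrite subrr normr0 subrr => _.
have V1 : V x <= V s by rewrite -subr_ge0; apply: le_trans (Vle _ _ (lexx x) xs sy).
have V2 : V s <= V y by rewrite -subr_ge0; apply: le_trans (Vle _ _ xs sy (lexx y)).
rewrite [`|h x - h s|]distrC => A1 A2.
have B1 : `|h s| * `|h s - h x| <= M * (V y - V x) by apply: ler_pM => //; lra.
have B2 : `|h x| * `|h y - h s| <= M * (V y - V x) by apply: ler_pM => //; lra.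
lra.
Qed.

End ACFunctions.

(** * Linear systems with continuous coefficients *)

Section LinearSystem.
Context {R : realType}.
Notation mu := (@lebesgue_measure R).
Implicit Types f g h : R -> R.

Lemma prim_cvg (f_ : nat -> R -> R) f (M : R) :
  (forall n, L1_01 (f_ n)) ->
  (forall n x, x \in `[0, 1] -> `|f_ n x| <= M) ->
  (forall x, x \in `[0, 1] -> f_ n x @[n --> \oo] --> f x) ->
  L1_01 f /\ forall x, x \in `[0, 1] -> prim (f_ n) x @[n --> \oo] --> prim f x.
Proof.
move=> Lf_ fM ff.
have mf : measurable_fun (`[0, 1] : set R) f.
  apply: (@measurable_fun_cvg _ _ _ _ f_) => // n.
  by apply/measurable_EFinP; case/integrableP: (Lf_ n).
have LM : L1_01 (fun=> M) by apply/cont01_L1/cont01_cst.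
have sub x : x \in `[0, 1] -> `[0, x] `<=` `[0, (1:R)].
  by move=> xI y /=; move: xI; rewrite !in_itv/=; lra.
have dct x (xI : x \in `[0, 1]) := @dominated_convergence _ _ _ mu `[0, x]
  (measurable_itv _) (fun n => EFin \o f_ n) (EFin \o f) (EFin \o fun=> M).
have {}dct x : x \in `[0, 1] -> mu.-integrable `[0, x] (EFin \o f) /\
    ((\int[mu]_(s in `[0%R, x]) (f_ n s)%:E) @[n --> \oo] -->
      \int[mu]_(s in `[0%R, x]) (f s)%:E)%E.
  move=> xI; have [|||||ix _ cx] := dct x xI; last by split.
  - move=> n; apply: measurable_int; apply: (integrableS _ _ _ (Lf_ n)) => //.
    exact: sub.
  - by apply/measurable_EFinP; apply: measurable_funS mf => //; exact: sub.
  - by apply: aeW => s /(sub _ xI) sI; apply: cvg_EFin; [exact: nearW|exact: ff].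
  - by apply: (integrableS _ _ _ LM) => //; exact: sub.
  - by apply: aeW => s n /(sub _ xI) sI /=; rewrite lee_fin; exact: fM.
have one_in01 : (1 : R) \in `[0, 1] by rewrite in_itv/= lexx ler01.
split=> [|x xI]; first exact: (dct 1 one_in01).1.
have [ix cx] := dct x xI.
have fin : (\int[mu]_(s in `[0%R, x]) (f s)%:E \is a fin_num)%E.
  by apply: integrable_fin_num.
by apply: fine_cvg; rewrite /prim /Rintegral fineK.
Qed.

Lemma geometric_increments_cvg (u : nat -> R) (C : R) :
  (forall n, `|u n.+1 - u n| <= C * 2^-1 ^+ n) -> cvgn u.
Proof.
move=> H; have hl : `|2^-1 : R| < 1 by rewrite ger0_norm ?invr_ge0//; lra.
have cg := @is_cvg_geometric_series _ C _ hl.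
have ct : cvgn (series (telescope u)).
  apply: (@normed_cvg _ R^o); apply: series_le_cvg cg.
  - by move=> n; exact: normr_ge0.
  - by move=> n; apply: le_trans (H n).
  - by move=> n; exact: H.
have -> : u = (fun n => u 0%N + series (telescope u) n).
  by apply/funext => n; exact: eq_sum_telescope.
by apply: is_cvgD => //; exact: is_cvg_cst.
Qed.

Lemma geometric_increments_bounded (u : nat -> R) (C : R) n :
  (forall n, `|u n.+1 - u n| <= C * 2^-1 ^+ n) -> `|u n| <= `|u 0%N| + 2 * C.
Proof.
move=> H; have C0 : 0 <= C by have := H 0%N; rewrite expr0 mulr1; apply: le_trans.
suff : `|u n - u 0%N| <= 2 * C * (1 - 2^-1 ^+ n).
  have p0 : 0 <= 2^-1 ^+ n :> R by rewrite exprn_ge0.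
  move=> Hn; have := ler_normD (u n - u 0%N) (u 0%N); rewrite subrK; nra.
elim: n => [|n IH]; first by rewrite subrr normr0 expr0 subrr mulr0.
have := ler_normD (u n.+1 - u n) (u n - u 0%N); rewrite addrA subrK => K.
by have := H n; rewrite exprS; lra.
Qed.

(** Everything below is measured in the weighted norm
sup exp(- k x) (|y| + |z|) with k = 4 K + 1: integrating the right-hand side from 0
then at least halves the norm, so that the Picard map contracts on all of [0, 1]
at once. *)
Section system.
Variables (a b c d : R -> R) (K : R).
Hypotheses (ca : cont01 a) (cb : cont01 b) (cc : cont01 c) (cd : cont01 d).
Hypotheses (aK : forall x, x \in `[0, 1] -> `|a x| <= K)
           (bK : forall x, x \in `[0, 1] -> `|b x| <= K)
           (cK : forall x, x \in `[0, 1] -> `|c x| <= K)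
           (dK : forall x, x \in `[0, 1] -> `|d x| <= K).
Let k := 4 * K + 1.

Let K0 : 0 <= K.
Proof.
have zero_in01 : (0 : R) \in `[0, 1] by rewrite in_itv/= lexx ler01.
by apply: le_trans (aK zero_in01).
Qed.

Let k0 : 0 < k. Proof. by have := K0; rewrite /k; lra. Qed.

Let comb_le (p r y z m x : R) : `|p| <= K -> `|r| <= K ->
  `|y| + `|z| <= m * expR (k * x) ->
  `|p * y + r * z| <= m / 4 * (k * expR (k * x)).
Proof.
move=> pK rK H; apply: le_trans (ler_normD _ _) _; rewrite !normrM.
have e0 := expR_gt0 (k * x).
apply: (@le_trans _ _ (K * (m * expR (k * x)))).
  have := normr_ge0 y; have := normr_ge0 z; have := K0; nra.
have m0 : 0 <= m * expR (k * x) by apply: le_trans H; rewrite addr_ge0.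
rewrite (_ : m / 4 * _ = (k / 4) * (m * expR (k * x))); last by ring.
by rewrite ler_wpM2r// /k; lra.
Qed.

(** At a maximum of exp(- k x) (|y| + |z|) the weighted norm m satisfies
m <= m / 2 + rho, hence m <= 2 rho. *)
Lemma linear_system_stable y z r (rho : R) :
  AC_deriv y (fun x => a x * y x + b x * z x) ->
  AC_deriv z (fun x => c x * y x + d x * z x + r x) ->
  y 0 = 0 -> z 0 = 0 -> (forall x, x \in `[0, 1] -> `|r x| <= rho) ->
  forall x, x \in `[0, 1] -> `|y x| + `|z x| <= 2 * rho * expR k.
Proof.
move=> ay az y0 z0 rr.
have rho0 : 0 <= rho.
  by have := rr 0; rewrite in_itv/= lexx ler01 => /(_ isT); apply: le_trans.
pose N x := (`|y x| + `|z x|) * expR (- (k * x)).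
have cN : cont01 N.
  apply: cont01M; first apply: cont01D.
  - by move=> x; apply: continuous_comp; [exact: (AC_cont ay)|exact: norm_continuous].
  - by move=> x; apply: continuous_comp; [exact: (AC_cont az)|exact: norm_continuous].
  - apply: cont01_ext (AC_cont (AC_expR 1 (- k))) => x _.
    by rewrite mul1r mulNr.
have [x0 xI Nmax] := EVT_max ler01 cN; set m := N x0 in Nmax.
have Nm x : x \in `[0, 1] -> `|y x| + `|z x| <= m * expR (k * x).
  move=> /Nmax; rewrite /N expRN ler_pdivrMr ?expR_gt0//.
have [x00 x01] : 0 <= x0 /\ x0 <= 1 by move: xI; rewrite in_itv/= => /andP.
have m0 : 0 <= m by rewrite /m /N mulr_ge0 ?addr_ge0 ?expR_ge0.
have e1 : 1 <= expR (k * x0) by rewrite -expR0 ler_expR mulr_ge0// ltW.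
have Hy : `|y x0 - y 0| <= m / 4 * expR (k * x0) - m / 4 * expR (k * 0).
  apply: (AC_norm_le ay (AC_expR (m / 4) k)) => // s sI.
  have sI' : s \in `[0, 1] by rewrite in_itv/=; lra.
  by apply: comb_le; [exact: aK|exact: bK|exact: Nm].
have Hz : `|z x0 - z 0| <= m / 4 * expR (k * x0) + rho * x0 - (m / 4 * expR (k * 0) + rho * 0).
  have ai : AC_deriv (fun x : R => x) (fun=> 1).
    by apply: AC_C1 => x; exact: cst_continuous.
  apply: (AC_norm_le az (ACD (AC_expR (m / 4) k) (ACZ rho ai))) => // s sI.
  have sI' : s \in `[0, 1] by rewrite in_itv/=; lra.
  apply: le_trans (ler_normD _ _) _; rewrite mulr1 lerD ?rr//.
  by apply: comb_le; [exact: cK|exact: dK|exact: Nm].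
rewrite y0 subr0 mulr0 expR0 mulr1 in Hy; rewrite z0 subr0 !mulr0 expR0 mulr1 in Hz.
have mE : `|y x0| + `|z x0| = m * expR (k * x0).
  by rewrite /m /N expRN mulfVK// gt_eqF// expR_gt0.
have m2 : m <= 2 * rho.
  have := mE; have : rho * x0 <= rho by nra.
  nra.
move=> x /[dup] xI' /Nm/le_trans; apply; apply: ler_pM => //; rewrite ?expR_ge0//.
rewrite ler_expR; move: xI'; rewrite in_itv/= => /andP[? ?]; have := k0; nra.
Qed.

Variables (y0 z0 : R).

Fixpoint picard n : (R -> R) * (R -> R) :=
  if n is m.+1 then
    (fun x => y0 + prim (fun s => a s * (picard m).1 s + b s * (picard m).2 s) x,
     fun x => z0 + prim (fun s => c s * (picard m).1 s + d s * (picard m).2 s) x)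
  else (fun=> y0, fun=> z0).

Let cont_picard n : cont01 (picard n).1 /\ cont01 (picard n).2.
Proof.
elim: n => [|n [IH1 IH2]] /=; first by split; exact: cont01_cst.
by split; apply: cont01D; [exact: cont01_cst| |exact: cont01_cst|];
  apply: AC_cont (AC_prim (cont01_L1 (cont01D _ _))); exact: cont01M.
Qed.

Let AC_picard n :
  AC_deriv (picard n.+1).1 (fun s => a s * (picard n).1 s + b s * (picard n).2 s) /\
  AC_deriv (picard n.+1).2 (fun s => c s * (picard n).1 s + d s * (picard n).2 s).
Proof.
have [c1 c2] := cont_picard n; split=> /=.
  have L : L1_01 (fun s => a s * (picard n).1 s + b s * (picard n).2 s).
    by apply/cont01_L1/cont01D; exact: cont01M.
  by apply: eq_AC (ACD (AC_cst y0) (AC_prim L)) => // x _; rewrite add0r.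
have L : L1_01 (fun s => c s * (picard n).1 s + d s * (picard n).2 s).
  by apply/cont01_L1/cont01D; exact: cont01M.
by apply: eq_AC (ACD (AC_cst z0) (AC_prim L)) => // x _; rewrite add0r.
Qed.

Let picard_incr : exists2 C, 0 <= C & forall n x, x \in `[0, 1] ->
  `|(picard n.+1).1 x - (picard n).1 x| + `|(picard n.+1).2 x - (picard n).2 x|
  <= C * 2^-1 ^+ n * expR (k * x).
Proof.
have [c1 c2] := cont_picard 1.
have [M1 M10 H1] := cont01_bounded (cont01D c1 (@cont01_cst R (- y0))).
have [M2 M20 H2] := cont01_bounded (cont01D c2 (@cont01_cst R (- z0))).
exists (M1 + M2); first exact: addr_ge0.
elim=> [|n IH] x xI.
  rewrite expr0 mulr1; have [x0 x1] : 0 <= x /\ x <= 1 by move: xI; rewrite in_itv/= => /andP.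
  apply: le_trans (lerD (H1 x xI) (H2 x xI)) _.
  by rewrite ler_peMr ?addr_ge0// -expR0 ler_expR mulr_ge0// ltW.
have [x0 x1] : 0 <= x /\ x <= 1 by move: xI; rewrite in_itv/= => /andP.
set D := (M1 + M2) * 2^-1 ^+ n in IH.
have D0 : 0 <= D by rewrite mulr_ge0 ?addr_ge0// exprn_ge0.
have sI s : 0 <= s <= x -> s \in `[0, 1] by rewrite in_itv/=; lra.
have [A1 A2] := AC_picard n.+1; have [B1 B2] := AC_picard n.
have P1 : `|((picard n.+2).1 x - (picard n.+1).1 x) - ((picard n.+2).1 0 - (picard n.+1).1 0)|
     <= D / 4 * expR (k * x) - D / 4 * expR (k * 0).
  apply: (AC_norm_le (ACB A1 B1) (AC_expR (D / 4) k)) => // s /sI sI'.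
  rewrite (_ : _ - _ = a s * ((picard n.+1).1 s - (picard n).1 s) +
    b s * ((picard n.+1).2 s - (picard n).2 s)); last by ring.
  by apply: comb_le; [exact: aK|exact: bK|exact: IH].
have P2 : `|((picard n.+2).2 x - (picard n.+1).2 x) - ((picard n.+2).2 0 - (picard n.+1).2 0)|
     <= D / 4 * expR (k * x) - D / 4 * expR (k * 0).
  apply: (AC_norm_le (ACB A2 B2) (AC_expR (D / 4) k)) => // s /sI sI'.
  rewrite (_ : _ - _ = c s * ((picard n.+1).1 s - (picard n).1 s) +
    d s * ((picard n.+1).2 s - (picard n).2 s)); last by ring.
  by apply: comb_le; [exact: cK|exact: dK|exact: IH].
have E1 m : (picard m.+1).1 0 = y0 by rewrite /= prim0 addr0.
have E2 m : (picard m.+1).2 0 = z0 by rewrite /= prim0 addr0.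
rewrite !E1 subrr subr0 mulr0 expR0 mulr1 in P1.
rewrite !E2 subrr subr0 mulr0 expR0 mulr1 in P2.
rewrite exprS (_ : _ * _ * expR _ = D / 2 * expR (k * x)); last by rewrite /D; ring.
lra.
Qed.

(** The increments of the Picard iterates decay like 2^-n; the pointwise limit is
a solution because bounded convergence passes to the limit in the integral
equation, so that its continuity comes for free. *)
Lemma linear_system_exists : exists y z : R -> R,
  [/\ y 0 = y0, z 0 = z0,
      AC_deriv y (fun x => a x * y x + b x * z x) &
      AC_deriv z (fun x => c x * y x + d x * z x)].
Proof.
have [C C0 H] := picard_incr.
pose y x := limn (fun n => (picard n).1 x).
pose z x := limn (fun n => (picard n).2 x).
have ek x : x \in `[0, 1] -> expR (k * x) <= expR k.
  rewrite in_itv/= => /andP[? ?]; rewrite ler_expR; have := k0; nra.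
have q0 n : 0 <= 2^-1 ^+ n :> R by rewrite exprn_ge0.
have inc1 x n : x \in `[0, 1] ->
    `|(picard n.+1).1 x - (picard n).1 x| <= C * expR k * 2^-1 ^+ n.
  move=> xI; have := H n x xI; have := ek x xI.
  have := normr_ge0 ((picard n.+1).2 x - (picard n).2 x).
  have : 0 <= C * 2^-1 ^+ n by rewrite mulr_ge0.
  nra.
have inc2 x n : x \in `[0, 1] ->
    `|(picard n.+1).2 x - (picard n).2 x| <= C * expR k * 2^-1 ^+ n.
  move=> xI; have := H n x xI; have := ek x xI.
  have := normr_ge0 ((picard n.+1).1 x - (picard n).1 x).
  have : 0 <= C * 2^-1 ^+ n by rewrite mulr_ge0.
  nra.
have cy x : x \in `[0, 1] -> (picard n).1 x @[n --> \oo] --> y x.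
  by move=> xI; apply: (@geometric_increments_cvg (fun n => (picard n).1 x) (C * expR k)) => n; exact: inc1.
have cz x : x \in `[0, 1] -> (picard n).2 x @[n --> \oo] --> z x.
  by move=> xI; apply: (@geometric_increments_cvg (fun n => (picard n).2 x) (C * expR k)) => n; exact: inc2.
have by1 n x : x \in `[0, 1] -> `|(picard n).1 x| <= `|y0| + 2 * (C * expR k).
  by move=> xI; apply: (@geometric_increments_bounded (fun n => (picard n).1 x)) => m; exact: inc1.
have bz1 n x : x \in `[0, 1] -> `|(picard n).2 x| <= `|z0| + 2 * (C * expR k).
  by move=> xI; apply: (@geometric_increments_bounded (fun n => (picard n).2 x)) => m; exact: inc2.
(* The two rows of the system have the same shape. *)
have lim_comb p r : cont01 p -> cont01 r ->
    (forall x, x \in `[0, 1] -> `|p x| <= K) -> (forall x, x \in `[0, 1] -> `|r x| <= K) ->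
    L1_01 (fun s => p s * y s + r s * z s) /\ forall x, x \in `[0, 1] ->
      prim (fun s => p s * (picard n).1 s + r s * (picard n).2 s) x @[n --> \oo] -->
      prim (fun s => p s * y s + r s * z s) x.
  move=> cp cr pK rK.
  apply: (@prim_cvg _ _ (K * (`|y0| + 2 * (C * expR k)) + K * (`|z0| + 2 * (C * expR k)))) => [n|n x xI|x xI].
  - by have [? ?] := cont_picard n; apply/cont01_L1/cont01D; exact: cont01M.
  - apply: le_trans (ler_normD _ _) _; rewrite !normrM lerD//.
      by apply: ler_pM => //; [exact: pK|exact: by1].
    by apply: ler_pM => //; [exact: rK|exact: bz1].
  - by apply: cvgD; apply: cvgMr; [exact: cy|exact: cz].
have zero_in01 : (0 : R) \in `[0, 1] by rewrite in_itv/= lexx ler01.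
have [Ly py] := lim_comb a b ca cb aK bK.
have [Lz pz] := lim_comb c d cc cd cK dK.
have yE x : x \in `[0, 1] -> y x = y0 + prim (fun s => a s * y s + b s * z s) x.
  move=> xI; have := cy x xI; rewrite -cvg_shiftS => /cvg_unique; apply => //.
  by apply: cvgD; [exact: cvg_cst|exact: py].
have zE x : x \in `[0, 1] -> z x = z0 + prim (fun s => c s * y s + d s * z s) x.
  move=> xI; have := cz x xI; rewrite -cvg_shiftS => /cvg_unique; apply => //.
  by apply: cvgD; [exact: cvg_cst|exact: pz].
exists y, z; split.
- by rewrite yE// prim0 addr0.
- by rewrite zE// prim0 addr0.
- apply: eq_AC (ACD (AC_cst y0) (AC_prim Ly)) => x xI; last by rewrite add0r.
  by rewrite yE.
- apply: eq_AC (ACD (AC_cst z0) (AC_prim Lz)) => x xI; last by rewrite add0r.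
  by rewrite zE.
Qed.

End system.
End LinearSystem.

(** * Solutions of the differential equation *)

Section Hill.
Context {R : realType}.
Variable q : R -> R.
Hypothesis Lq : L1_01 q.
Implicit Types f g y w u : R -> R.

Definition solves (l : R) y y1 :=
  AC_deriv y y1 /\ AC_deriv y1 (fun x => (q x - l) * y x).

Lemma solves_comb l a b y y1 w w1 : solves l y y1 -> solves l w w1 ->
  solves l (fun x => a * y x + b * w x) (fun x => a * y1 x + b * w1 x).
Proof.
move=> [Y1 Y2] [W1 W2]; split; first by apply: ACD; exact: ACZ.
by apply: eq_AC (ACD (ACZ a Y2) (ACZ b W2)) => x _ //; ring.
Qed.

Lemma lagrange_identity l u u1 y y1 : AC_deriv u u1 -> solves l y y1 ->
  AC_deriv (fun x => u x * y1 x) (fun x => u1 x * y1 x + (q x - l) * u x * y x).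
Proof.
move=> U [Y1 Y2]; apply: eq_AC (ACM U Y2) => x _ //; ring.
Qed.

Lemma wronskian l y y1 w w1 x : solves l y y1 -> solves l w w1 ->
  x \in `[0, 1] -> y x * w1 x - y1 x * w x = y 0 * w1 0 - y1 0 * w 0.
Proof.
move=> Y W; have A := ACB (lagrange_identity Y.1 W) (lagrange_identity W.1 Y).
move=> /(AC_deriv0_cst A) H; rewrite [y1 x * _]mulrC [y1 0 * _]mulrC; apply: H.
move=> s _; ring.
Qed.

Let P := prim q.
Let aP : AC_deriv P q. Proof. exact: AC_prim. Qed.
Let cP : cont01 P. Proof. exact: AC_cont aP. Qed.

Lemma quasi_derivative_bound l : exists2 K, 1 <= K & forall m x, x \in `[0, 1] ->
  `|m - l| <= 1 -> `|P x| <= K /\ `|- (m + P x * P x)| <= K.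
Proof.
have [M M0 PM] := cont01_bounded cP.
exists (1 + M + `|l| + M * M + 1) => [|m x xI ml].
  have := normr_ge0 l; nra.
have := PM x xI; have l0 := normr_ge0 l; split; first nra.
rewrite normrN; apply: le_trans (ler_normD _ _) _; rewrite normrM.
have := ler_normD (m - l) l; rewrite subrK.
have := normr_ge0 (P x); nra.
Qed.

(** With P a primitive of q, the quasi-derivative z = y' - P y no longer sees q
itself: (y, z) solves a system whose coefficients are continuous, although q is
only integrable. *)
Lemma quasi_derivative l y y1 : solves l y y1 ->
  let z x := y1 x - P x * y x in
  AC_deriv y (fun x => P x * y x + 1 * z x) /\
  AC_deriv z (fun x => - (l + P x * P x) * y x + - P x * z x).
Proof.
move=> [Y1 Y2] z; split; first by apply: eq_AC Y1 => x _ //; rewrite /z; ring.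
by apply: eq_AC (ACB Y2 (ACM aP Y1)) => x _ //; rewrite /z; ring.
Qed.

Let cont_coef l : [/\ cont01 P, cont01 (fun=> 1 : R),
  cont01 (fun x => - (l + P x * P x)) & cont01 (fun x => - P x)].
Proof.
have cN : cont01 (fun x => - P x).
  by apply: cont01_ext (cont01M (@cont01_cst R (-1)) cP) => x _; rewrite mulN1r.
split=> //; first exact: cont01_cst.
apply: (@cont01_ext _ (fun x => - l + - P x * P x)) => [x _|]; first ring.
by apply: cont01D; [exact: cont01_cst|exact: cont01M].
Qed.

Lemma solves_exists l a b : exists y y1, [/\ solves l y y1, y 0 = a & y1 0 = b].
Proof.
have [K K1 H] := quasi_derivative_bound l.
have {}H x : x \in `[0, 1] -> `|P x| <= K /\ `|- (l + P x * P x)| <= K.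
  by move=> xI; apply: H => //; rewrite subrr normr0.
have [c1 c2 c3 c4] := cont_coef l.
have [||||y [z [y0 z0 Y Z]]] := @linear_system_exists R _ _ _ _ K c1 c2 c3 c4 _ _ _ _ a b.
- by move=> x /H[].
- by move=> x _; rewrite normr1.
- by move=> x /H[].
- by move=> x /H[? _]; rewrite normrN.
have A := ACD Z (ACM aP Y).
exists y, (fun x => z x + P x * y x); split=> //; last first.
  by rewrite z0 /P prim0 mul0r addr0.
split; first by apply: eq_AC Y => x _ //; ring.
by apply: eq_AC A => x _ //; ring.
Qed.

(** The difference of the solutions at m and at l solves the linear system at m
with the forcing term (l - m) y, which is O(|m - l|). *)
Lemma solves_lipschitz l y y1 : solves l y y1 -> exists2 C, 0 <= C &
  forall m w w1, `|m - l| <= 1 -> solves m w w1 -> w 0 = y 0 -> w1 0 = y1 0 ->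
  forall x, x \in `[0, 1] -> `|w x - y x| <= C * `|m - l| /\ `|w1 x - y1 x| <= C * `|m - l|.
Proof.
move=> Y; have [K K1 H] := quasi_derivative_bound l.
have [M M0 yM] := cont01_bounded (AC_cont Y.1).
pose C0 := 2 * M * expR (4 * K + 1).
have C00 : 0 <= C0 by rewrite !mulr_ge0 ?expR_ge0.
exists (C0 + K * C0) => [|m w w1 ml W w0 w10 x xI].
  have K0 : 0 <= K by lra.
  by rewrite addr_ge0// mulr_ge0.
have {}H x' : x' \in `[0, 1] -> `|P x'| <= K /\ `|- (m + P x' * P x')| <= K.
  by move=> xI'; exact: H xI' ml.
have [c1 c2 c3 c4] := cont_coef m.
have [Y1 Y2] := quasi_derivative Y; have [W1 W2] := quasi_derivative W.
pose D x := w x - y x.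
pose E x := (w1 x - P x * w x) - (y1 x - P x * y x).
have aD : AC_deriv D (fun x => P x * D x + 1 * E x).
  by apply: eq_AC (ACB W1 Y1) => s _ //; rewrite /D /E; ring.
have aE : AC_deriv E (fun x => - (m + P x * P x) * D x + - P x * E x + - ((m - l) * y x)).
  by apply: eq_AC (ACB W2 Y2) => s _ //; rewrite /D /E; ring.
have D0 : D 0 = 0 by rewrite /D w0 subrr.
have E0 : E 0 = 0 by rewrite /E w0 w10 subrr.
have rM s : s \in `[0, 1] -> `|- ((m - l) * y s)| <= `|m - l| * M.
  by move=> sI; rewrite normrN normrM ler_wpM2l// yM.
have PK s : s \in `[0, 1] -> `|P s| <= K by case/H.
have NK s : s \in `[0, 1] -> `|- P s| <= K by rewrite normrN; case/H.
have QK s : s \in `[0, 1] -> `|- (m + P s * P s)| <= K by case/H.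
have OK (s : R) : s \in `[0, 1] -> `|1 : R| <= K by rewrite normr1.
have := @linear_system_stable R P (fun=> 1) (fun s => - (m + P s * P s))
  (fun s => - P s) K PK OK QK NK D E _ _ aD aE D0 E0 rM x xI.
rewrite (_ : 2 * _ * _ = C0 * `|m - l|); last by rewrite /C0; ring.
have := normr_ge0 (D x); have := normr_ge0 (E x); have := normr_ge0 (m - l).
have -> : w1 x - y1 x = E x + P x * D x by rewrite /E /D; ring.
move=> ml0 E00 D00 DE; have Dx : `|D x| <= C0 * `|m - l| by lra.
split; first by have : 0 <= K * C0 * `|m - l|; [rewrite !mulr_ge0//; lra|rewrite /D in Dx *; lra].
apply: le_trans (ler_normD _ _) _; rewrite normrM mulrDl.
have : `|P x| * `|D x| <= K * (C0 * `|m - l|) by apply: ler_pM => //; exact: PK.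
lra.
Qed.
End Hill.

(** * Positivity and the quadratic form *)

Section Form.
Context {R : realType}.
Implicit Types f g h u v w y : R -> R.

Definition positive_inside y := forall x : R, 0 < x -> x <= 1 -> 0 < y x.

Lemma initial_slope y1 : cont01 y1 -> y1 0 = 1 ->
  exists d : R, [/\ 0 < d, d <= 1 & forall x, 0 <= x -> x <= d -> 2^-1 <= y1 x].
Proof.
move=> c1 y10.
have [_ c0 _] := (continuous_within_itvP y1 ltr01).1 c1.
have : \forall x \near (0 : R)^'+, `|y1 0 - y1 x| < 2^-1.
  by move/cvgrPdist_lt : c0; apply; rewrite invr_gt0.
move=> [d /= d0 H]; exists (Num.min (d / 2) 1); split.
- by rewrite lt_min ltr01 divr_gt0.
- by rewrite ge_min lexx orbT.
move=> x x0; rewrite le_min => /andP[xd x1].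
have [->|xn0] := eqVneq x 0; first by rewrite y10; lra.
have xp : 0 < x by rewrite lt_neqAle eq_sym xn0.
have := H x; rewrite /ball/= sub0r normrN gtr0_norm// y10 => /(_ _ xp).
have : x < d by lra.
by move=> xd' /(_ xd'); rewrite ltr_norml; lra.
Qed.

Lemma slope_growth y y1 (c d x : R) : AC_deriv y y1 -> d <= 1 ->
  (forall s, 0 <= s -> s <= d -> c <= y1 s) ->
  0 <= x -> x <= d -> y 0 + c * x <= y x.
Proof.
move=> Y d1 H x0 xd.
have : y 0 - c * 0 <= y x - c * x.
  apply: (AC_le (ACB Y (ACZ c AC_id))) => // [|s /andP[s0 sx]]; first lra.
  by rewrite mulr1 subr_ge0 H//; lra.
lra.
Qed.

(** Near 0 the slope of y is about 1 and keeps w increasing; away from 0 the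
function y has a positive minimum.  Smallness must therefore be asked of both
w - y and its derivative. *)
Lemma positive_inside_stable y y1 : AC_deriv y y1 -> cont01 y1 ->
  y 0 = 0 -> y1 0 = 1 -> positive_inside y ->
  exists2 e : R, 0 < e & forall w w1, AC_deriv w w1 -> 0 <= w 0 ->
    (forall x, x \in `[0, 1] -> `|w x - y x| <= e) ->
    (forall x, x \in `[0, 1] -> `|w1 x - y1 x| <= e) -> positive_inside w.
Proof.
move=> Y c1 y0 y10 yp; have [d [d0 d1 dH]] := initial_slope c1 y10.
have [m m0 mH] : exists2 m, 0 < m & forall x, d <= x -> x <= 1 -> m <= y x.
  have cy : {within `[d, 1], continuous y}.
    have := AC_cont Y; apply: continuous_subspaceW => x /=.
    by rewrite !in_itv/=; lra.
  have [c] := EVT_min d1 cy; rewrite in_itv/= => /andP[dc c1'] cm.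
  exists (y c); first by apply: yp => //; lra.
  by move=> x dx x1; apply: cm; rewrite in_itv/= dx.
exists (Num.min 4^-1 (m / 2)); first by rewrite lt_min; lra.
move=> w w1 W w0 wy w1y x x0 x1.
have [xd|/ltW dx] := leP x d.
  have w1d s : 0 <= s -> s <= d -> 4^-1 <= w1 s.
    move=> s0 sd; have sI : s \in `[0, 1] by rewrite in_itv/=; lra.
    have := w1y s sI; rewrite le_min => /andP[+ _]; rewrite ler_norml.
    by have := dH s s0 sd; lra.
  by have := slope_growth W d1 w1d (ltW x0) xd; lra.
have xI : x \in `[0, 1] by rewrite in_itv/=; lra.
have := wy x xI; rewrite le_min => /andP[_ +]; rewrite ler_norml.
by have := mH x dx x1; lra.
Qed.

Variable q : R -> R.
Hypothesis Lq : L1_01 q.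

Definition energy_density (l : R) u u1 := fun x : R => u1 x ^+ 2 + (q x - l) * u x ^+ 2.

Lemma solves_cont l y y1 : solves q l y y1 -> cont01 y /\ cont01 y1.
Proof. by move=> [/AC_cont ? /AC_cont]. Qed.

(** Jacobi's identity: with p = h'/h, which satisfies p' + p^2 = q - l, the
energy density of v minus (p v^2)' is the square (v' - p v)^2. *)
Lemma jacobi_ge0 l h h1 v v1 E : solves q l h h1 ->
  (forall x, x \in `[0, 1] -> 0 < h x) -> AC_deriv v v1 -> v 0 = 0 -> v 1 = 0 ->
  AC_deriv E (energy_density l v v1) -> E 0 <= E 1.
Proof.
move=> [H H1] hp V v0 v1' aE; have aI := AC_inv H hp.
pose p x := h1 x * (h x)^-1.
have aG := ACB aE (ACM (ACM H1 aI) (ACM V V)).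
have := AC_le aG (lexx 0) ler01 (lexx 1).
rewrite v0 v1' !mulr0 !subr0; apply => x xI.
have xI' : x \in `[0, 1] by rewrite in_itv.
have hx : h x != 0 by rewrite gt_eqF ?hp.
rewrite (_ : _ - _ = (v1 x - p x * v x) ^+ 2) ?sqr_ge0// /p /energy_density.
by field.
Qed.

Lemma solves_energy l y y1 : solves q l y y1 ->
  AC_deriv (fun x => y x * y1 x) (energy_density l y y1).
Proof.
move=> Y; apply: eq_AC (lagrange_identity Y.1 Y) => x _ //.
by rewrite /energy_density; ring.
Qed.

Section fundamental.
Variables (l : R) (phi phi1 psi psi1 : R -> R).
Hypotheses (Phi : solves q l phi phi1) (Psi : solves q l psi psi1).
Hypotheses (phi0 : phi 0 = 1) (phi10 : phi1 0 = 0) (psi0 : psi 0 = 0) (psi10 : psi1 0 = 1).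

Lemma wronskian1 x : x \in `[0, 1] -> phi x * psi1 x - phi1 x * psi x = 1.
Proof. by move=> /(wronskian Phi Psi) ->; rewrite phi0 psi10 phi10; ring. Qed.

(** psi + k phi with k > 0 small: the term k phi only repairs the zero of psi
at 0. *)
Lemma positive_solution : positive_inside psi ->
  exists h h1, solves q l h h1 /\ forall x, x \in `[0, 1] -> 0 < h x.
Proof.
move=> pp; have [c0 c1] := solves_cont Psi; have [d0 d1] := solves_cont Phi.
have [e e0 H] := positive_inside_stable Psi.1 c1 psi0 psi10 pp.
have [M M0 HM] := cont01_bounded d0; have [N N0 HN] := cont01_bounded d1.
pose k := e / (M + N + 1).
have k0 : 0 < k by rewrite divr_gt0//; lra.
have kM : k * (M + N + 1) = e by rewrite /k divfK// gt_eqF//; lra.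
have S := solves_comb 1 k Psi Phi.
exists (fun x => 1 * psi x + k * phi x), (fun x => 1 * psi1 x + k * phi1 x).
split=> // x; rewrite in_itv/= => /andP[x0 x1].
have [->|xn0] := eqVneq x 0; first by rewrite psi0 phi0; lra.
apply: (H _ _ S.1) => //; last by rewrite lt_neqAle eq_sym xn0.
- by rewrite psi0 phi0; lra.
- move=> s sI; rewrite mul1r addrAC subrr add0r normrM gtr0_norm//.
  by have := HM s sI; nra.
- move=> s sI; rewrite mul1r addrAC subrr add0r normrM gtr0_norm//.
  by have := HN s sI; nra.
Qed.

(** Subtract from u the solution y with the same boundary values.  The energy is
the sum of those of u - y and of y, since the mixed term is the increment of
2 (u - y) y'; the first is nonnegative by Jacobi's identity, and the second is
y(1) y'(1) - y(0) y'(0), computed with the Wronskian. *)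
Lemma energy_lower_bound u u1 E : positive_inside psi -> AC_deriv u u1 ->
  AC_deriv E (energy_density l u u1) ->
  (u 0 ^+ 2 * phi 1 - 2 * u 0 * u 1 + u 1 ^+ 2 * psi1 1) / psi 1 <= E 1 - E 0.
Proof.
move=> pp U aE; have [h [h1 [H hp]]] := positive_solution pp.
have p1 : 0 < psi 1 by exact: pp.
pose d := (u 1 - u 0 * phi 1) / psi 1.
have S := solves_comb (u 0) d Phi Psi.
set y := (fun x => _) in S; set y1 := (fun x => _) in S.
have aV := ACB U S.1.
have aF : AC_deriv (fun x => E x - 2 * ((u x - y x) * y1 x) - y x * y1 x)
    (energy_density l (fun x => u x - y x) (fun x => u1 x - y1 x)).
  apply: eq_AC (ACB (ACB aE (ACZ 2 (lagrange_identity aV S))) (solves_energy S)) => x _ //.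
  by rewrite /energy_density; ring.
have y0 : y 0 = u 0 by rewrite /y phi0 psi0; ring.
have y1' : y 1 = u 1 by rewrite /y /d; field; rewrite gt_eqF.
have y10 : y1 0 = d by rewrite /y1 phi10 psi10; ring.
have := jacobi_ge0 H hp aV _ _ aF.
rewrite y0 y1' !subrr !mul0r !mulr0 !subr0 => /(_ erefl erefl).
suff -> : (u 0 ^+ 2 * phi 1 - 2 * u 0 * u 1 + u 1 ^+ 2 * psi1 1) / psi 1 =
   u 1 * y1 1 - u 0 * y1 0 by lra.
rewrite y10 /y1 /d; have W := wronskian1 one_in01.
have -> : phi1 1 = (phi 1 * psi1 1 - 1) / psi 1.
  by rewrite (_ : _ - 1 = phi1 1 * psi 1) ?mulfK ?gt_eqF//; lra.
by field; rewrite gt_eqF.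
Qed.

Lemma energy_density_L1 u u1 : cont01 u -> cont01 u1 ->
  L1_01 (energy_density l u u1).
Proof.
move=> cu cu1; apply: L1D; first by apply/cont01_L1/cont01M.
apply: L1M (cont01M cu cu).
by apply: L1_ext (L1D Lq (cont01_L1 (@cont01_cst R (- l)))) => x _.
Qed.

(** The real and imaginary parts g cos(s x) and g sin(s x) of g exp(i s x) have
energies that add up to the form on the left; the bounds of
[energy_lower_bound] combine into the discriminant. *)
Lemma twisted_energy_lower_bound (s : R) g g1 F : positive_inside psi ->
  AC_deriv g g1 -> cont01 g1 -> g 0 = g 1 ->
  AC_deriv F (fun x => g1 x ^+ 2 + (q x - l + s ^+ 2) * g x ^+ 2) ->
  g 0 ^+ 2 * (phi 1 + psi1 1 - 2 * cos s) / psi 1 <= F 1 - F 0.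
Proof.
move=> pp G c1 g01 aF; have cg := AC_cont G.
pose C x := cos (s * x); pose S x := sin (s * x).
have aC := AC_cos s; have aS := AC_sin s; rewrite -/C -/S in aC aS.
have cC := AC_cont aC; have cS := AC_cont aS.
pose u1 x := g1 x * C x + g x * - (s * S x).
pose v1 x := g1 x * S x + g x * (s * C x).
have U : AC_deriv (fun x => g x * C x) u1 by exact: ACM G aC.
have V : AC_deriv (fun x => g x * S x) v1 by exact: ACM G aS.
have cu1 : cont01 u1.
  apply: cont01_ext (cont01D (cont01M c1 cC)
    (cont01M (@cont01_cst R (- s)) (cont01M cg cS))) => x _.
  by rewrite /u1; ring.
have cv1 : cont01 v1.
  apply: cont01_ext (cont01D (cont01M c1 cS)
    (cont01M (@cont01_cst R s) (cont01M cg cC))) => x _.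
  by rewrite /v1; ring.
have aE := AC_prim (energy_density_L1 (AC_cont U) cu1).
have aH := AC_prim (energy_density_L1 (AC_cont V) cv1).
have Eu := energy_lower_bound pp U aE; have Ev := energy_lower_bound pp V aH.
have CS x : C x ^+ 2 + S x ^+ 2 = 1 by exact: cos2Dsin2.
have aEH : AC_deriv (fun x => prim (energy_density l (fun x => g x * C x) u1) x +
    prim (energy_density l (fun x => g x * S x) v1) x)
    (fun x => g1 x ^+ 2 + (q x - l + s ^+ 2) * g x ^+ 2).
  apply: eq_AC (ACD aE aH) => x _ //; rewrite /energy_density /u1 /v1.
  transitivity (g1 x ^+ 2 * (C x ^+ 2 + S x ^+ 2) +
    (q x - l + s ^+ 2) * g x ^+ 2 * (C x ^+ 2 + S x ^+ 2)).
    by rewrite /C /S; ring.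
  by rewrite CS !mulr1.
have -> := AC_eq_incr aF aEH zero_in01 one_in01.
rewrite opprD addrACA; apply: le_trans (lerD Eu Ev).
rewrite /C /S mulr0 cos0 sin0 !mulr0 !mulr1 -g01 -/(C 1) -/(S 1).
rewrite -mulrDl le_eqVlt; apply/orP; left; apply/eqP; congr (_ / _).
transitivity (g 0 ^+ 2 * (phi 1 + psi1 1 * (C 1 ^+ 2 + S 1 ^+ 2) - 2 * C 1)).
  by rewrite CS /C !mulr1.
by rewrite /C /S !mulr1; ring.
Qed.

End fundamental.
End Form.

(** * Eigenvalues and the discriminant *)

Section Spectrum.
Context {R : realType}.
Notation mu := (@lebesgue_measure R).
Implicit Types f g h u v w y : R -> R.

Variable q : R -> R.
Hypothesis Lq : L1_01 q.

(** u and v are the real and imaginary parts of an eigenfunction. *)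
Definition real_eigenpair (t l : R) u u1 v v1 :=
  [/\ solves q l u u1, solves q l v v1,
      u 1 = cos t * u 0 - sin t * v 0 /\ v 1 = sin t * u 0 + cos t * v 0,
      u1 1 = cos t * u1 0 - sin t * v1 0 /\ v1 1 = sin t * u1 0 + cos t * v1 0 &
      exists2 x, x \in `[0, 1] & (u x != 0) || (v x != 0)].

Lemma eigenvalue_realP t l :
  eigenvalue_L q t l <-> exists u u1 v v1, real_eigenpair t l u u1 v v1.
Proof.
split.
  move=> [y [y1 [y2 [[Y Yi] [Y1 Y1i] ae bc bc1]]]] [x xI yx].
  pose cR (z : R[i]) := complex.Re z; pose cI (z : R[i]) := complex.Im z.
  have cplxE (a b : R[i]) : a = b -> cR a = cR b /\ cI a = cI b by move=> ->.
  have Ll u u1 : AC_deriv u u1 -> L1_01 (fun x => (q x - l) * u x).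
    move=> /AC_cont cu; apply: L1M cu.
    by apply: L1_ext (L1D Lq (cont01_L1 (@cont01_cst R (- l)))) => s _.
  exists (fun x => cR (y x)), (fun x => cR (y1 x)), (fun x => cI (y x)), (fun x => cI (y1 x)).
  split.
  - split=> //; apply: AC_ext Y1 _ (Ll _ _ Y) _ => //.
    apply: (@filterS _ _ (ae_filter_ringOfSetsType mu) _ _ _ ae) => s H sI.
    have := H sI; rewrite /cR; case: (y s) => a b; case: (y2 s) => a2 b2.
    by move=> /cplxE [/= E _]; rewrite /=; move: E; rewrite /cR/=; lra.
  - split=> //; apply: AC_ext Y1i _ (Ll _ _ Yi) _ => //.
    apply: (@filterS _ _ (ae_filter_ringOfSetsType mu) _ _ _ ae) => s H sI.
    have := H sI; rewrite /cI; case: (y s) => a b; case: (y2 s) => a2 b2.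
    by move=> /cplxE [_ /= E]; rewrite /=; move: E; rewrite /cI/=; lra.
  - by rewrite bc /cR /cI; case: (y 0) => a b /=; split; ring.
  - by rewrite bc1 /cR /cI; case: (y1 0) => a b /=; split; ring.
  - exists x => //; move: yx; rewrite eq_complex negb_and.
    by rewrite /cR /cI; case: (y x).
move=> [u [u1 [v [v1 [[U U1] [V V1] [bu bv] [bu1 bv1] [x xI ux]]]]]].
exists (fun x => (u x +i* v x)%C).
  exists (fun x => (u1 x +i* v1 x)%C), (fun x => ((q x - l) * u x +i* ((q x - l) * v x))%C).
  split=> //=.
  - by apply: aeW => s _; apply/eqP; rewrite eq_complex /=; apply/andP; split; apply/eqP; ring.
  - by apply/eqP; rewrite eq_complex /= bu bv; apply/andP; split; apply/eqP; ring.
  - by apply/eqP; rewrite eq_complex /= bu1 bv1; apply/andP; split; apply/eqP; ring.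
by exists x => //; rewrite eq_complex /= negb_and.
Qed.

Section fundamental.
Variables (l : R) (phi phi1 psi psi1 : R -> R).
Hypotheses (Phi : solves q l phi phi1) (Psi : solves q l psi psi1).
Hypotheses (phi0 : phi 0 = 1) (phi10 : phi1 0 = 0) (psi0 : psi 0 = 0) (psi10 : psi1 0 = 1).

Lemma psi_pos_near0 : exists d : R, [/\ 0 < d, d <= 1 &
  forall x, 0 <= x -> x <= d -> x / 2 <= psi x].
Proof.
have [_ c1] := solves_cont Psi.
have [d [d0 d1 dH]] := initial_slope c1 psi10; exists d; split=> // x x0 xd.
by have := slope_growth Psi.1 d1 dH x0 xd; rewrite psi0; lra.
Qed.

(** D(l) = 2 cos t says that exp(it) is an eigenvalue of the monodromy matrix,
which has determinant 1.  If psi(1) <> 0 an eigenvector is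
(psi(1), exp(it) - phi(1)).  If psi(1) = 0 the matrix is triangular and its
diagonal entries psi'(1) and 1/psi'(1) have sum 2 cos t, which leaves
psi'(1) = cos t = exp(it) real, so that psi itself is an eigenfunction. *)
Lemma discriminant_eigenvalue t : phi 1 + psi1 1 = 2 * cos t -> eigenvalue_L q t l.
Proof.
move=> D; have W := wronskian1 Phi Psi phi0 phi10 psi10 one_in01.
have [d [d0 d1 dH]] := psi_pos_near0.
have dI : d \in `[0, 1] by rewrite in_itv/= d1 ltW.
have pd : 0 < psi d by have := dH d (ltW d0) (lexx d); lra.
have cs := cos2Dsin2 t.
apply/eigenvalue_realP; have [p1|p1] := eqVneq (psi 1) 0.
  have {}W : phi 1 * psi1 1 = 1 by move: W; rewrite p1 mulr0 subr0.
  have : (psi1 1 - cos t) ^+ 2 + sin t ^+ 2 = 0.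
    transitivity (psi1 1 ^+ 2 - 2 * cos t * psi1 1 + (cos t ^+ 2 + sin t ^+ 2)); first by ring.
    rewrite cs -D. transitivity (1 - phi 1 * psi1 1); [ring|by rewrite W subrr].
  move/eqP; rewrite paddr_eq0 ?sqr_ge0// !sqrf_eq0 subr_eq0 => /andP[/eqP E /eqP s0].
  have Z := solves_comb 0 0 Psi Psi.
  exists psi, psi1, (fun x => 0 * psi x + 0 * psi x), (fun x => 0 * psi1 x + 0 * psi1 x).
  split=> //.
  - by rewrite psi0 p1 s0; split; ring.
  - by rewrite psi10 E s0; split; ring.
  - by exists d => //; rewrite gt_eqF.
have U := solves_comb (psi 1) (cos t - phi 1) Phi Psi.
have V := solves_comb 0 (sin t) Phi Psi.
exists (fun x => psi 1 * phi x + (cos t - phi 1) * psi x),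
  (fun x => psi 1 * phi1 x + (cos t - phi 1) * psi1 x),
  (fun x => 0 * phi x + sin t * psi x), (fun x => 0 * phi1 x + sin t * psi1 x).
split=> //.
- by rewrite phi0 psi0; split; ring.
- rewrite phi10 psi10; have -> : psi1 1 = 2 * cos t - phi 1 by rewrite -D; ring.
  have -> : psi 1 * phi1 1 = phi 1 * (2 * cos t - phi 1) - 1.
    by rewrite -[X in _ - X]W -D; ring.
  have s2 : sin t * sin t = 1 - cos t * cos t by rewrite -!expr2; lra.
  by split; rewrite !(mulr1, mulr0, mul0r, add0r, addr0) ?s2; ring.
- by exists 0; [exact: zero_in01|rewrite phi0 psi0 mulr1 mulr0 addr0 p1].
Qed.

(** The lower bound s^2 / 4 is the square of psi(s) >= s / 2 near 0. *)
Lemma AC_pos_increment F f d x : AC_deriv F f -> 0 < d -> d <= 1 ->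
  (forall s, s \in `[0, 1] -> 0 <= f s) ->
  (forall s, 0 <= s -> s <= d -> s ^+ 2 / 4 <= f s) ->
  0 < x -> x <= 1 -> F 0 < F x.
Proof.
move=> aF d0 d1 f0 fd x0 x1; pose e := Num.min x d.
have e0 : 0 < e by rewrite /e lt_min x0.
have ex : e <= x by rewrite /e ge_min lexx.
have ed : e <= d by rewrite /e ge_min lexx orbT.
have aC : AC_deriv (fun s : R => 12^-1 * (s * (s * s))) (fun s => s ^+ 2 / 4).
  by apply: eq_AC (ACZ 12^-1 (ACM AC_id (ACM AC_id AC_id))) => s _ //; field.
have H1 : F 0 - 12^-1 * (0 * (0 * 0)) <= F e - 12^-1 * (e * (e * e)).
  apply: (AC_le (ACB aF aC)) => [||| s /andP[s0 se]]; [exact: lexx|exact: ltW|lra|].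
  by rewrite subr_ge0 fd//; lra.
have H2 : F e <= F x.
  apply: (AC_le aF) => // [|s /andP[s0 sx]]; first exact: ltW.
  by apply: f0; rewrite in_itv/=; lra.
have : 0 < 12^-1 * (e * (e * e)) by rewrite !mulr_gt0// invr_gt0.
lra.
Qed.

End fundamental.

Let c := prim q 1.
Let T x := prim q x - c * x.

Lemma AC_centred_primitive : AC_deriv T (fun x => q x - c).
Proof. by apply: eq_AC (ACB (AC_prim Lq) (ACZ c AC_id)) => x _ //; rewrite mulr1. Qed.

(** T is a primitive of q minus its mean that vanishes at both ends.  Removing
(T u^2)' from the energy density replaces q by its mean at the price of
- 2 T u u', which u'^2 absorbs as soon as l is below the mean by more than
max T^2.  No boundary condition on u is used. *)
Lemma low_energy_bound : exists L, forall l u u1 E, l <= L -> AC_deriv u u1 ->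
  AC_deriv E (energy_density q l u u1) ->
  exists G, [/\ forall x, G x = E x - T x * u x ^+ 2 &
    exists g, AC_deriv G g /\ forall x, x \in `[0, 1] -> u x ^+ 2 <= g x].
Proof.
have aT := AC_centred_primitive; have [M M0 HM] := cont01_bounded (AC_cont aT).
exists (c - M ^+ 2 - 1) => l u u1 E lL U aE.
exists (fun x => E x - T x * (u x * u x)); split=> [x|]; first by rewrite expr2.
have aG := ACB aE (ACM aT (ACM U U)).
eexists; split; first exact: aG.
move=> x xI; have TM := HM x xI.
have T2 : T x ^+ 2 <= M ^+ 2 by move: TM; rewrite ler_norml => /andP[? ?]; nra.
rewrite -subr_ge0 /energy_density.
rewrite (_ : _ - _ = (u1 x - T x * u x) ^+ 2 + (c - l - T x ^+ 2 - 1) * u x ^+ 2); last by ring.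
by rewrite addr_ge0 ?sqr_ge0// mulr_ge0 ?sqr_ge0//; lra.
Qed.

Let T0 : T 0 = 0. Proof. by rewrite /T prim0 mulr0 subrr. Qed.
Let T1 : T 1 = 0. Proof. by rewrite /T mulr1 subrr. Qed.

(** For psi, the energy on [0, x] is psi(x) psi'(x), so that its strict
positivity excludes zeros of psi.  For the solution equal to 1 at both ends, the
energy is (D(l) - 2) / psi(1). *)
Lemma low_energy : exists L, forall l phi phi1 psi psi1, l <= L ->
  solves q l phi phi1 -> solves q l psi psi1 ->
  phi 0 = 1 -> phi1 0 = 0 -> psi 0 = 0 -> psi1 0 = 1 ->
  positive_inside psi /\ 2 <= phi 1 + psi1 1.
Proof.
have [L HL] := low_energy_bound; exists L => l phi phi1 psi psi1 lL Phi Psi p0 p10 s0 s10.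
have [d [d0 d1 dH]] := psi_pos_near0 Psi s0 s10.
have nz x : 0 < x -> x <= 1 -> psi x != 0.
  move=> x0 x1; have [G [GE [g [aG gE]]]] := HL _ _ _ _ lL Psi.1 (solves_energy Psi).
  have : G 0 < G x.
    apply: (AC_pos_increment aG d0 d1) => // [s sI|s s0' sd].
      by apply: le_trans (gE s sI); exact: sqr_ge0.
    have sI : s \in `[0, 1] by rewrite in_itv/= s0'; lra.
    apply: le_trans (gE s sI); have := dH s s0' sd; nra.
  rewrite !GE s0; apply: contraTneq => ->.
  by rewrite !mul0r expr0n/= !mulr0 ltxx.
have pp : positive_inside psi.
  move=> x x0 x1; have [xd|/ltW dx] := leP x d.
    by have := dH x (ltW x0) xd; lra.
  rewrite ltNge; apply/negP => px.
  have pd : 0 < psi d by have := dH d (ltW d0) (lexx d); lra.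
  have cw : {within `[d, x], continuous psi}.
    have := AC_cont Psi.1; apply: continuous_subspaceW => z /=.
    by rewrite !in_itv/=; lra.
  have [|z] := @IVT R psi d x 0 dx cw; first by rewrite ge_min px orbT le_max (ltW pd).
  rewrite in_itv/= => /andP[dz zx] /eqP; apply/negP; apply: nz; lra.
split=> //; have p1 : 0 < psi 1 by exact: pp.
pose k := (1 - phi 1) / psi 1.
have S := solves_comb 1 k Phi Psi.
have [G [GE [g [aG gE]]]] := HL _ _ _ _ lL S.1 (solves_energy S).
have : G 0 <= G 1.
  apply: (AC_le aG) => // x xI; apply: le_trans (gE x _); last by rewrite in_itv.
  exact: sqr_ge0.
rewrite !GE T0 T1 p0 p10 s0 s10 !mul0r !subr0.
have W := wronskian1 Phi Psi p0 p10 s10 one_in01.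
have -> : phi1 1 = (phi 1 * psi1 1 - 1) / psi 1.
  by rewrite (_ : _ - 1 = phi1 1 * psi 1) ?mulfK ?gt_eqF//; lra.
rewrite /k -subr_ge0 (_ : _ - _ = (phi 1 + psi1 1 - 2) / psi 1); last first.
  by field; rewrite gt_eqF.
by rewrite pmulr_lge0 ?invr_gt0// subr_ge0.
Qed.

End Spectrum.

(** * Below the spectrum *)

Section BelowSpectrum.
Context {R : realType}.
Implicit Types f g h u v w y : R -> R.

Lemma min_left_slope y y1 x : AC_deriv y y1 -> cont01 y1 ->
  (forall s, s \in `[0, 1] -> 0 <= y s) -> 0 < x -> x <= 1 -> y x = 0 -> y1 x <= 0.
Proof.
move=> Y c1 yp x0 x1 yx; rewrite leNgt; apply/negP => s0.
have cx : {within `[0, x], continuous y1}.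
  by apply: continuous_subspaceW c1 => z /=; rewrite !in_itv/=; lra.
have [_ _ cl] := (continuous_within_itvP y1 x0).1 cx.
have : \forall z \near x^'-, `|y1 x - y1 z| < y1 x.
  by move/cvgrPdist_lt : cl; apply.
move=> [d /= d0 H]; pose e := Num.max 0 (x - d / 2).
have ex : e < x by rewrite /e gt_max x0/=; lra.
have e0 : 0 <= e by rewrite /e le_max lexx.
have ed : x - d / 2 <= e by rewrite /e le_max lexx orbT.
have pz z : e <= z -> z <= x -> 0 < y1 z.
  move=> ez; rewrite le_eqVlt => /predU1P[->//|zx].
  have := H z; rewrite /ball/= gtr0_norm ?subr_gt0// => /(_ _ zx).
  have zd : x - z < d by lra.
  by move=> /(_ zd); rewrite ltr_norml; lra.
have cw : {within `[e, x], continuous y1}.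
  by apply: continuous_subspaceW c1 => z /=; rewrite !in_itv/=; lra.
have [z] := EVT_min (ltW ex) cw; rewrite in_itv/= => /andP[ez zx] zm.
have m0 : 0 < y1 z by exact: pz.
have := AC_le (ACB Y (ACZ (y1 z) AC_id)) e0 (ltW ex) x1.
rewrite yx => L; have : y e - y1 z * e <= 0 - y1 z * x.
  by apply: L => s sI; rewrite mulr1 subr_ge0; apply: zm; rewrite in_itv.
have : 0 <= y e by apply: yp; rewrite in_itv/= e0; lra.
have : 0 < y1 z * (x - e) by rewrite mulr_gt0// subr_gt0.
lra.
Qed.

Lemma min_right_slope y y1 x : AC_deriv y y1 -> cont01 y1 ->
  (forall s, s \in `[0, 1] -> 0 <= y s) -> 0 <= x -> x < 1 -> y x = 0 -> 0 <= y1 x.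
Proof.
move=> Y c1 yp x0 x1 yx; rewrite leNgt; apply/negP => s0.
have cx : {within `[x, 1], continuous y1}.
  by apply: continuous_subspaceW c1 => z /=; rewrite !in_itv/=; lra.
have [_ cr _] := (continuous_within_itvP y1 x1).1 cx.
have : \forall z \near x^'+, `|y1 x - y1 z| < - y1 x.
  by move/cvgrPdist_lt : cr; apply; lra.
move=> [d /= d0 H]; pose e := Num.min 1 (x + d / 2).
have ex : x < e by rewrite /e lt_min x1/=; lra.
have e1 : e <= 1 by rewrite /e ge_min lexx.
have ed : e <= x + d / 2 by rewrite /e ge_min lexx orbT.
have pz z : x <= z -> z <= e -> y1 z < 0.
  rewrite le_eqVlt => /predU1P[<-//|xz ze].
  have := H z; rewrite /ball/= distrC gtr0_norm ?subr_gt0// => /(_ _ xz).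
  have zd : z - x < d by lra.
  by move=> /(_ zd); rewrite ltr_norml; lra.
have cw : {within `[x, e], continuous y1}.
  by apply: continuous_subspaceW c1 => z /=; rewrite !in_itv/=; lra.
have [z] := EVT_max (ltW ex) cw; rewrite in_itv/= => /andP[xz ze] zm.
have m0 : y1 z < 0 by exact: pz.
have := AC_le (ACB (ACZ (y1 z) AC_id) Y) x0 (ltW ex) e1.
rewrite yx => L; have : y1 z * x - 0 <= y1 z * e - y e.
  by apply: L => s sI; rewrite mulr1 subr_ge0; apply: zm; rewrite in_itv.
have : 0 <= y e by apply: yp; rewrite in_itv/= e1; lra.
have : 0 < - y1 z * (e - x) by rewrite mulr_gt0//; lra.
lra.
Qed.

Variable q : R -> R.
Hypothesis Lq : L1_01 q.

(** A zero of psi >= 0 inside (0, 1) is double, against the Wronskian.  At 1 the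
Wronskian gives phi(1) psi'(1) = 1 with psi'(1) < 0, and then
phi(1) + psi'(1) <= -2. *)
Lemma ge0_positive_inside l phi phi1 psi psi1 :
  solves q l phi phi1 -> solves q l psi psi1 ->
  phi 0 = 1 -> phi1 0 = 0 -> psi 0 = 0 -> psi1 0 = 1 ->
  - 2 < phi 1 + psi1 1 -> (forall x, x \in `[0, 1] -> 0 <= psi x) ->
  positive_inside psi.
Proof.
move=> Phi Psi p0 p10 s0 s10 D pge x x0 x1.
have xI : x \in `[0, 1] by rewrite in_itv/= x1 ltW.
rewrite lt_neqAle pge// andbT eq_sym; apply/eqP => px.
have [_ c1] := solves_cont Psi.
have W := wronskian1 Phi Psi p0 p10 s10 xI.
have L := min_left_slope Psi.1 c1 pge x0 x1 px.
rewrite px mulr0 subr0 in W.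
have [xl|xg] := ltP x 1.
  have Rr := min_right_slope Psi.1 c1 pge (ltW x0) xl px.
  have E : psi1 x = 0 by apply/eqP; rewrite eq_le L.
  by move: W; rewrite E mulr0 => /esym/eqP; rewrite oner_eq0.
have xE : x = 1 by apply/eqP; rewrite eq_le x1.
rewrite xE in W L; have {}L : psi1 1 < 0.
  rewrite lt_neqAle L andbT; apply/eqP => E.
  by move: W; rewrite E mulr0 => /esym/eqP; rewrite oner_eq0.
have : (phi 1 + psi1 1 + 2) * psi1 1 = (1 + psi1 1) ^+ 2 + (phi 1 * psi1 1 - 1) by ring.
rewrite W subrr addr0 => E; have := sqr_ge0 (1 + psi1 1); nra.
Qed.

Variables phi phi1 psi psi1 : R -> R -> R.
Hypotheses (Phi : forall l, solves q l (phi l) (phi1 l))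
           (Psi : forall l, solves q l (psi l) (psi1 l))
           (phi0 : forall l, phi l 0 = 1) (phi10 : forall l, phi1 l 0 = 0)
           (psi0 : forall l, psi l 0 = 0) (psi10 : forall l, psi1 l 0 = 1).

Definition discriminant l := phi l 1 + psi1 l 1.

Lemma discriminant_continuous : continuous discriminant.
Proof.
move=> l; apply/cvgrPdist_le => e e0.
have [C C0 HC] := solves_lipschitz Lq (Phi l).
have [B B0 HB] := solves_lipschitz Lq (Psi l).
exists (Num.min 1 (e / (C + B + 1))) => /=.
  by rewrite lt_min ltr01 divr_gt0//; lra.
move=> m /=; rewrite lt_min distrC => /andP[m1 me].
have [H1 _] := HC m _ _ (ltW m1) (Phi m) (etrans (phi0 m) (esym (phi0 l)))
  (etrans (phi10 m) (esym (phi10 l))) 1 one_in01.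
have [_ H2] := HB m _ _ (ltW m1) (Psi m) (etrans (psi0 m) (esym (psi0 l)))
  (etrans (psi10 m) (esym (psi10 l))) 1 one_in01.
have : `|m - l| * (C + B + 1) < e by rewrite -ltr_pdivlMr//; lra.
move=> ?; rewrite distrC /discriminant; have := normr_ge0 (m - l).
rewrite (_ : phi m 1 + _ - _ = (phi m 1 - phi l 1) + (psi1 m 1 - psi1 l 1)); last by ring.
have := ler_normD (phi m 1 - phi l 1) (psi1 m 1 - psi1 l 1); lra.
Qed.

Lemma positive_inside_open l : positive_inside (psi l) ->
  exists2 d : R, 0 < d & forall m, `|m - l| < d -> positive_inside (psi m).
Proof.
move=> pl; have [_ c1] := solves_cont (Psi l).
have [e e0 H] := positive_inside_stable (Psi l).1 c1 (psi0 l) (psi10 l) pl.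
have [B B0 HB] := solves_lipschitz Lq (Psi l).
exists (Num.min 1 (e / (B + 1))); first by rewrite lt_min ltr01 divr_gt0//; lra.
move=> m; rewrite lt_min => /andP[m1 me].
have {}HB := HB m _ _ (ltW m1) (Psi m) (etrans (psi0 m) (esym (psi0 l)))
  (etrans (psi10 m) (esym (psi10 l))).
have me' : B * `|m - l| <= e.
  have : `|m - l| * (B + 1) < e by rewrite -ltr_pdivlMr//; lra.
  have := normr_ge0 (m - l); lra.
apply: (H _ _ (Psi m).1); first by rewrite psi0.
- by move=> x /HB[H1 _]; lra.
- by move=> x /HB[_ H2]; lra.
Qed.

Lemma psi_ge0_closed l : (forall e, 0 < e -> exists2 m, `|m - l| < e &
    positive_inside (psi m)) -> forall x, x \in `[0, 1] -> 0 <= psi l x.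
Proof.
move=> H x xI; rewrite leNgt; apply/negP => px.
have [B B0 HB] := solves_lipschitz Lq (Psi l).
have [|m me pm] := H (Num.min 1 (- psi l x / (B + 1))).
  by rewrite lt_min ltr01 divr_gt0//; lra.
move: me; rewrite lt_min => /andP[m1 me].
have [H1 _] := HB m _ _ (ltW m1) (Psi m) (etrans (psi0 m) (esym (psi0 l)))
  (etrans (psi10 m) (esym (psi10 l))) x xI.
have : 0 <= psi m x.
  move: xI; rewrite in_itv/= => /andP[x0 x1].
  have [->|xn] := eqVneq x 0; first by rewrite psi0.
  by apply/ltW/pm => //; rewrite lt_neqAle eq_sym xn.
have : `|m - l| * (B + 1) < - psi l x by rewrite -ltr_pdivlMr//; lra.
have := normr_ge0 (m - l); move: H1; rewrite ler_norml; lra.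
Qed.

(** Start from L given by [low_energy].  The discriminant stays above 2 cos t on
[L, l] by the intermediate value theorem.  Positivity of psi is open in the
parameter, and closed because the discriminant is above -2, so it propagates
from L to l; the supremum S below carries this argument. *)
Lemma below_spectrum (t r l : R) :
  (forall m, m < r -> ~ eigenvalue_L q t m) -> l < r ->
  positive_inside (psi l) /\ 2 * cos t <= discriminant l.
Proof.
move=> noev lr; have [L HL] := low_energy Lq.
have {}HL m : m <= L -> positive_inside (psi m) /\ 2 <= discriminant m.
  by move=> mL; apply: (HL m _ (phi1 m) _ _ mL).
have c1 := cos_le1 t; have cN1 := cos_geN1 t.
have [lL|/ltW Ll] := leP l L; first by have [? ?] := HL l lL; split=> //; lra.
have Dgt m : L <= m -> m <= l -> 2 * cos t < discriminant m.
  move=> Lm ml; rewrite ltNge; apply/negP => Dm.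
  have cw : {within `[L, m], continuous discriminant}.
    by apply: continuous_subspaceT; exact: discriminant_continuous.
  have [|z] := @IVT R discriminant L m (2 * cos t) Lm cw.
    have [_ DL] := HL L (lexx L).
    by rewrite ge_min le_max Dm orbT/=; apply/orP; left; lra.
  rewrite in_itv/= => /andP[Lz zm] zE.
  apply: (noev z); first lra.
  exact: (discriminant_eigenvalue Lq (Phi z) (Psi z)).
split; last by apply/ltW/Dgt.
(* S collects the parameters up to which positivity has propagated. *)
pose S := [set m : R | L <= m <= l /\ forall n, L <= n -> n <= m -> positive_inside (psi n)].
have SL : S L.
  split; first by rewrite lexx.
  by move=> n Ln nL; case: (HL n nL).
have hS : has_sup S by split; [exists L|exists l => m [/andP[]]].
have [Ls sl] : L <= sup S /\ sup S <= l.
  by split; [exact: (ub_le_sup hS.2)|apply: ge_sup; [exists L|move=> m [/andP[]]]].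
have below n : L <= n -> n < sup S -> positive_inside (psi n).
  move=> Ln nS; have e0 : 0 < sup S - n by rewrite subr_gt0.
  have [m [_ mS] mn] := sup_adherent e0 hS.
  by apply: mS => //; lra.
have ps : positive_inside (psi (sup S)).
  apply: (ge0_positive_inside (Phi _) (Psi _)) => //.
    by have := Dgt _ Ls sl; rewrite /discriminant; lra.
  apply: psi_ge0_closed => e e0.
  have [m mS mn] := sup_adherent e0 hS.
  have mub : m <= sup S by exact: (ub_le_sup hS.2).
  case: mS => /andP[Lm _] mS; exists m; last exact: mS.
  by rewrite ltr_norml; lra.
have [d d0 Hd] := positive_inside_open ps.
have [lS|Sl] := leP l (sup S); first by have <- : sup S = l by apply/eqP; rewrite eq_le sl.
pose m := Num.min (sup S + d / 2) l.
have mS : S m.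
  have mS : sup S < m by rewrite /m lt_min Sl; lra.
  have ml : m <= l by rewrite /m ge_min lexx orbT.
  have md : m <= sup S + d / 2 by rewrite /m ge_min lexx.
  split; first by rewrite ml; lra.
  move=> n Ln nm; have [nS|Sn] := ltP n (sup S); first exact: below.
  by apply: Hd; rewrite ltr_norml; lra.
have := ub_le_sup hS.2 mS.
have : sup S < m by rewrite /m lt_min Sl; lra.
by lra.
Qed.

End BelowSpectrum.

(** * Rigidity of potentials of mean zero *)

Section Rigidity.
Context {R : realType}.
Notation mu := (@lebesgue_measure R).
Implicit Types f g h u v w y : R -> R.

(** By Lebesgue's differentiation theorem f is almost everywhere the derivative of
its primitive. *)
Lemma prim_eq0_ae f : L1_01 f -> (forall x, x \in `[0, 1] -> prim f x = 0) ->
  {ae mu, forall x, x \in `[0, 1] -> f x = 0}.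
Proof.
move=> Lf f0; pose k := f \_ `[0, 1].
have Lk : mu.-integrable setT (EFin \o k).
  by rewrite -restrict_EFin; apply/integrable_restrict => //=; rewrite setTI.
have ik (z : R) : mu.-integrable `]-oo, z] (EFin \o k).
  by apply: integrableS Lk.
have lk : locally_integrable [set: R] k by apply: integrable_locally.
have k0 x : \int[mu]_(t in `]-oo, x]) k t = 0.
  rewrite -Rintegral_mkcondr.
  have [x0|x0] := ltP x 0.
    rewrite (_ : _ `&` _ = set0) ?Rintegral_set0//.
    by apply/seteqP; split=> z //=; rewrite !in_itv/=; lra.
  have [x1|/ltW x1] := leP x 1.
    rewrite (_ : _ `&` _ = `[0, x]%classic); first by apply: f0; rewrite in_itv/= x0.
    by apply/seteqP; split=> z /=; rewrite !in_itv/=; lra.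
  rewrite (_ : _ `&` _ = `[0, (1:R)]%classic); first exact: f0 one_in01.
  by apply/seteqP; split=> z /=; rewrite !in_itv/=; lra.
have := FTC1Ny ik lk.
rewrite (_ : (fun x => \int[mu]_(t in `]-oo, x]) k t) = fun=> 0); last exact/funext.
move=> H; apply: (@filterS _ _ (ae_filter_ringOfSetsType mu) _ _ _ H) => x [_ E] xI.
by move: E; rewrite derive1_cst /k patchE mem_set.
Qed.

Variable q : R -> R.
Hypothesis Lq : L1_01 q.

Lemma fundamental_system : exists phi phi1 psi psi1 : R -> R -> R, forall l,
  [/\ solves q l (phi l) (phi1 l), solves q l (psi l) (psi1 l),
      phi l 0 = 1 /\ phi1 l 0 = 0 & psi l 0 = 0 /\ psi1 l 0 = 1].
Proof.
have [phi H] := choice (fun l => solves_exists Lq l 1 0).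
have [phi1 {}H] := choice H.
have [psi K] := choice (fun l => solves_exists Lq l 0 1).
have [psi1 {}K] := choice K.
exists phi, phi1, psi, psi1 => l; have [? ? ?] := H l; have [? ? ?] := K l.
by split.
Qed.

(** For every l < s^2 the form at l is nonnegative; then l tends to s^2. *)
Lemma twisted_form_ge0 (t s : R) g g1 F : cos s = cos t ->
  (forall m, m < s ^+ 2 -> ~ eigenvalue_L q t m) ->
  AC_deriv g g1 -> cont01 g1 -> g 0 = g 1 ->
  AC_deriv F (fun x => g1 x ^+ 2 + q x * g x ^+ 2) -> F 0 <= F 1.
Proof.
move=> csE noev G c1 g01 aF.
have [phi [phi1 [psi [psi1 H]]]] := fundamental_system.
have Phi l : solves q l (phi l) (phi1 l) by have [] := H l.
have Psi l : solves q l (psi l) (psi1 l) by have [] := H l.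
have phi0 l : phi l 0 = 1 by have [_ _ []] := H l.
have phi10 l : phi1 l 0 = 0 by have [_ _ []] := H l.
have psi0 l : psi l 0 = 0 by have [_ _ _ []] := H l.
have psi10 l : psi1 l 0 = 1 by have [_ _ _ []] := H l.
have cg := AC_cont G.
have aK := AC_prim (cont01_L1 (cont01M cg cg)); set K := prim _ in aK.
have K0 : 0 <= K 1 by apply: Rintegral_ge0 => x _; rewrite -expr2 sqr_ge0.
have lower l : l < s ^+ 2 -> 0 <= F 1 - F 0 + (s ^+ 2 - l) * K 1.
  move=> ls; have [pp D] := below_spectrum Lq Phi Psi phi0 phi10 psi0 psi10 noev ls.
  have aFK : AC_deriv (fun x => F x + (s ^+ 2 - l) * K x)
      (fun x => g1 x ^+ 2 + (q x - l + s ^+ 2) * g x ^+ 2).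
    by apply: eq_AC (ACD aF (ACZ (s ^+ 2 - l) aK)) => x _ //; ring.
  have := twisted_energy_lower_bound Lq (Phi l) (Psi l) (phi0 l) (phi10 l)
    (psi0 l) (psi10 l) pp G c1 g01 aFK.
  rewrite [K 0]prim0 mulr0 addr0 => B.
  have : 0 <= g 0 ^+ 2 * (phi l 1 + psi1 l 1 - 2 * cos s) / psi l 1.
    apply: divr_ge0; last by apply/ltW/pp.
    apply: mulr_ge0; first exact: sqr_ge0.
    by rewrite csE subr_ge0.
  by lra.
rewrite leNgt; apply/negP => F10.
pose e := (F 0 - F 1) / (2 * (K 1 + 1)).
have e0 : 0 < e by rewrite divr_gt0//; lra.
have eE : e * (2 * (K 1 + 1)) = F 0 - F 1 by rewrite /e divfK// gt_eqF//; lra.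
have := lower (s ^+ 2 - e) _; rewrite subKr => /(_ _) L.
have : s ^+ 2 - e < s ^+ 2 by lra.
by move=> /L; nra.
Qed.

(** With P the primitive of q and m its mean, take g = 1 + e w where w' = P - m.
Since int q = 0, the form is - 2 e int (P - m)^2 + O(e^2), which is nonnegative
for small e > 0 only if P is constant, that is P = 0. *)
Lemma mean_zero_rigidity :
  (forall g g1 F, AC_deriv g g1 -> cont01 g1 -> g 0 = g 1 ->
    AC_deriv F (fun x => g1 x ^+ 2 + q x * g x ^+ 2) -> F 0 <= F 1) ->
  prim q 1 = 0 -> {ae mu, forall x, x \in `[0, 1] -> q x = 0}.
Proof.
move=> Hform Q0; pose P := prim q; have aP : AC_deriv P q by exact: AC_prim.
have cP := AC_cont aP; pose m := prim P 1; pose w1 x := P x - m.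
have P0 : P 0 = 0 by rewrite /P prim0.
have cw1 : cont01 w1 by apply: cont01D => //; exact: cont01_cst.
pose w := prim w1; have aw : AC_deriv w w1 by exact/AC_prim/cont01_L1.
have aPP : AC_deriv (fun x => prim P x - m * x) w1.
  apply: eq_AC (ACB (AC_prim (cont01_L1 cP)) (ACZ m AC_id)) => x _ //.
  by rewrite mulr1.
have w0 : w 0 = 0 by rewrite /w prim0.
have w1E : w 1 = 0.
  have := AC_eq_incr aw aPP zero_in01 one_in01; rewrite w0 prim0 -/m; lra.
have cw := AC_cont aw.
have aN := AC_prim (cont01_L1 (cont01M cw1 cw1)); set N := prim _ in aN.
have N0 : N 0 = 0 by rewrite /N prim0.
have LK : L1_01 (fun x => w1 x ^+ 2 + q x * w x ^+ 2).
  by apply: L1D; [apply/cont01_L1/cont01M|apply: L1M => //; exact: cont01M].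
have aK := AC_prim LK; set K := prim _ in aK.
have K0 : K 0 = 0 by rewrite /K prim0.
pose J x := P x * w x - N x - m * w x.
have aJ : AC_deriv J (fun x => q x * w x).
  by apply: eq_AC (ACB (ACB (ACM aP aw) aN) (ACZ m aw)) => x _ //; rewrite /w1; ring.
(* The form at g = 1 + e w; by parts, int q w = - int w1^2. *)
have form e : 0 <= - 2 * e * N 1 + e ^+ 2 * K 1.
  have aG : AC_deriv (fun x => 1 + e * w x) (fun x => e * w1 x).
    by apply: eq_AC (ACD (AC_cst 1) (ACZ e aw)) => x _ //; rewrite add0r.
  have aF : AC_deriv (fun x => P x + 2 * e * J x + e ^+ 2 * K x)
      (fun x => (e * w1 x) ^+ 2 + q x * (1 + e * w x) ^+ 2).
    by apply: eq_AC (ACD (ACD aP (ACZ (2 * e) aJ)) (ACZ (e ^+ 2) aK)) => x _ //; ring.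
  have := Hform _ _ _ aG _ _ aF; rewrite w0 w1E => /(_ _ erefl) L.
  have : cont01 (fun x => e * w1 x) by apply: cont01M => //; exact: cont01_cst.
  move=> /L; rewrite /J P0 [P 1]Q0 w0 w1E N0 K0; lra.
have NN : 0 <= N 1 by apply: Rintegral_ge0 => x _; rewrite -expr2 sqr_ge0.
have {}N1 : N 1 = 0.
  apply/eqP; rewrite eq_le NN andbT leNgt; apply/negP => Np.
  pose k := `|K 1| + 1; have k0 : 0 < k by rewrite /k ltr_wpDl.
  pose e := N 1 / k; have e0 : 0 < e by rewrite divr_gt0.
  have ek : e * k = N 1 by rewrite /e divfK// gt_eqF.
  have := form e; have := ler_norm (K 1); rewrite /k in ek; nra.
have Nx x : x \in `[0, 1] -> N x = 0.
  rewrite in_itv/= => /andP[x0 x1].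
  have sq s : 0 <= w1 s * w1 s by rewrite -expr2 sqr_ge0.
  apply/eqP; rewrite eq_le; apply/andP; split.
    by rewrite -N1; apply: (AC_le aN).
  by rewrite -N0; apply: (AC_le aN).
have w1ae := prim_eq0_ae (cont01_L1 (cont01M cw1 cw1)) Nx.
have aw1 : AC_deriv w1 q.
  by apply: eq_AC (ACB aP (AC_cst m)) => x _ //; rewrite subr0.
(* w1 = 0 almost everywhere, so (w1^2)' = 2 q w1 = 0: w1^2 is the constant m^2,
   and its integral N 1 is 0. *)
have aw1w1 : AC_deriv (fun x => w1 x * w1 x) (fun=> 0).
  apply: (AC_ext (ACM aw1 aw1)) => //; first by case: (AC_cst (0 : R)).
  apply: (@filterS _ _ (ae_filter_ringOfSetsType mu) _ _ _ w1ae) => x H xI.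
  have /eqP := H xI; rewrite mulf_eq0 orbb => /eqP ->; ring.
have sqE x : x \in `[0, 1] -> w1 x * w1 x = m * m.
  move=> xI; rewrite (AC_deriv0_cst aw1w1 _ xI)// /w1 P0; ring.
have m0 : m = 0.
  have aN' : AC_deriv N (fun=> m * m) by apply: eq_AC aN => // x /sqE.
  have aM : AC_deriv (fun x => m * m * x) (fun=> m * m).
    by apply: eq_AC (ACZ (m * m) AC_id) => x _ //; rewrite mulr1.
  have := AC_eq_incr aN' aM zero_in01 one_in01; rewrite N1 N0 => E.
  by apply/eqP; rewrite -[_ == _]orbb -mulf_eq0; apply/eqP; lra.
apply: prim_eq0_ae => // x xI; have /eqP := sqE x xI.
by rewrite /w1 m0 subr0 mul0r mulf_eq0 orbb => /eqP.
Qed.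

End Rigidity.

(** * The Riemann-Lebesgue lemma *)

Section RiemannLebesgue.
Context {R : realType}.
Notation mu := (@lebesgue_measure R).
Implicit Types f g h u v w y : R -> R.

(** The solution of h' = n (g - h) averages g over the past with the weight
n exp(- n (x - s)), so it tends to g; unlike convolution it stays inside [0, 1]
and is absolutely continuous by the product rule alone. *)
Lemma exponential_smoothing g (n : R) : cont01 g -> 0 < n -> exists h,
  [/\ h 0 = g 0, AC_deriv h (fun x => n * (g x - h x)) &
   AC_deriv (fun x => expR (n * x) * h x) (fun x => n * expR (n * x) * g x)].
Proof.
move=> cg n0; have aE := AC_expR 1 n; have cE := AC_cont aE.
have aD := AC_expR 1 (- n).
have L : L1_01 (fun x => n * expR (n * x) * g x).
  apply/cont01_L1/cont01M => //; apply: cont01M; first exact: cont01_cst.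
  by apply: cont01_ext cE => x _; rewrite mul1r.
have aP := ACD (AC_cst (g 0)) (AC_prim L).
have EN (x : R) : expR (n * x) * expR (- n * x) = 1.
  by rewrite -expRD mulNr subrr expR0.
exists (fun x => expR (- n * x) * (g 0 + prim (fun x => n * expR (n * x) * g x) x)).
split.
- by rewrite mulr0 expR0 prim0; ring.
- apply: eq_AC (ACM aD aP) => x _; first by rewrite mul1r.
  transitivity (n * (expR (n * x) * expR (- n * x) * g x -
    expR (- n * x) * (g 0 + prim (fun x => n * expR (n * x) * g x) x))); first by ring.
  by rewrite EN mul1r.
- apply: eq_AC aP => x _; last by rewrite add0r.
  by rewrite mulrA EN mul1r.
Qed.

Lemma exponential_smoothing_le g h (n M : R) : 0 < n ->
  (forall x, x \in `[0, 1] -> `|g x| <= M) -> h 0 = g 0 ->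
  AC_deriv (fun x => expR (n * x) * h x) (fun x => n * expR (n * x) * g x) ->
  forall x, x \in `[0, 1] -> `|h x| <= M.
Proof.
move=> n0 gM h0 aE x; rewrite in_itv/= => /andP[x0 x1].
have e0 := expR_gt0 (n * x).
have B : `|expR (n * x) * h x - expR (n * 0) * h 0| <=
    M * expR (n * x) - M * expR (n * 0).
  apply: (AC_norm_le aE (AC_expR M n)) => // s /andP[s0 sx].
  have sI : s \in `[0, 1] by rewrite in_itv/=; lra.
  have es := expR_gt0 (n * s).
  rewrite !normrM (gtr0_norm n0) (gtr0_norm es) mulrC ler_wpM2r ?gM//.
  by rewrite mulr_ge0 ?ltW.
rewrite mulr0 expR0 mul1r mulr1 in B.
have := gM 0 zero_in01; rewrite -h0 => h0M.
have : `|expR (n * x) * h x| <= M * expR (n * x).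
  by have := ler_normD (expR (n * x) * h x - h 0) (h 0); rewrite subrK; lra.
by rewrite normrM gtr0_norm// mulrC ler_pM2r.
Qed.

(** The smoothings stay below sup |g| and converge pointwise: over a window
[a, x] where g is within d / 2 of g x, the smoothing forgets its value at a at
the rate exp(- n (x - a)). *)
Lemma continuous_L1_approx g (e : R) : cont01 g -> 0 < e -> exists h h',
  AC_deriv h h' /\ prim (fun x => `|g x - h x|) 1 <= e.
Proof.
move=> cg e0; have [M M0 gM] := cont01_bounded cg.
have [h H] := choice (fun n : nat => exponential_smoothing cg (ltr0Sn R n)).
have hM n x : x \in `[0, 1] -> `|h n x| <= M.
  by have [? ? ?] := H n; apply: exponential_smoothing_le (ltr0Sn R n) gM _ _ _.
have ch n : cont01 (h n) by have [_ /AC_cont] := H n.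
have L n : L1_01 (fun x => `|g x - h n x|).
  apply: L1_norm; apply: L1D; first exact: cont01_L1.
  by apply: L1_ext (L1Z (-1) (cont01_L1 (ch n))) => x _; rewrite mulN1r.
have [||_ H1] := @prim_cvg R (fun n x => `|g x - h n x|) (fun=> 0) (2 * M) L.
- move=> n x xI; rewrite normr_id; apply: le_trans (ler_normB _ _) _.
  by have := hM n x xI; have := gM x xI; lra.
- move=> x xI; apply/cvgrPdist_le => d d0.
  have [x0 x1] : 0 <= x /\ x <= 1 by move: xI; rewrite in_itv/= => /andP.
  have [r r0 rH] : exists2 r : R, 0 < r & forall s, 0 <= s -> x - r < s -> s <= x ->
      `|g s - g x| <= d / 2.
    have [->|xn0] := eqVneq x 0.
      exists 1 => // s s0 _ sx; have -> : s = 0 by lra.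
      by rewrite subrr normr0 divr_ge0// ltW.
    have xp : 0 < x by rewrite lt_neqAle eq_sym xn0.
    have cx : {within `[0, x], continuous g}.
      by apply: continuous_subspaceW cg => z /=; rewrite !in_itv/=; lra.
    have [_ _ cl] := (continuous_within_itvP g xp).1 cx.
    have : \forall z \near x^'-, `|g x - g z| <= d / 2.
      by move/cvgrPdist_le : cl; apply; rewrite divr_gt0.
    move=> [r /= r0 rH]; exists r => // s s0 xs; rewrite le_eqVlt => /predU1P[->|sx].
      by rewrite subrr normr0 divr_ge0// ltW.
    rewrite distrC; apply: rH => //; rewrite /ball/= gtr0_norm ?subr_gt0//; lra.
  pose a := Num.max 0 (x - r / 2).
  have a0 : 0 <= a by rewrite /a le_max lexx.
  have ax : a <= x by rewrite /a ge_max x0; lra.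
  have ar : x - r < a by rewrite /a lt_max; apply/orP; right; lra.
  have key n : `|g x - h n x| <= d / 2 + expR (- (n.+1%:R * (x - a))) * `|h n a - g x|.
    have [h0 _ aE] := H n; set N : R := n.+1%:R in aE *.
    have ex := expR_gt0 (N * x); have ea := expR_gt0 (N * a).
    have aF := ACB aE (AC_expR (g x) N).
    have B := AC_norm_le aF (AC_expR (d / 2) N) a0 ax x1.
    have {}B : `|expR (N * x) * h n x - g x * expR (N * x) -
        (expR (N * a) * h n a - g x * expR (N * a))| <=
        d / 2 * expR (N * x) - d / 2 * expR (N * a).
      apply: B => s /andP[sa sx]; have es := expR_gt0 (N * s).
      rewrite (_ : _ - _ = (g s - g x) * (N * expR (N * s))); last by ring.
      rewrite normrM [`|N * _|]gtr0_norm ?mulr_gt0 ?ltr0Sn//.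
      apply: ler_wpM2r; first by rewrite mulr_ge0// ltW.
      by apply: rH => //; lra.
    rewrite (_ : expR (- _) = expR (N * a) / expR (N * x)); last first.
      by rewrite -expRN -expRD; congr expR; ring.
    rewrite distrC -(ler_pM2l ex) mulrDr.
    rewrite (_ : _ * (_ / _ * _) = expR (N * a) * `|h n a - g x|); last first.
      by field; rewrite gt_eqF.
    have -> : expR (N * x) * `|h n x - g x| = `|expR (N * x) * h n x - g x * expR (N * x)|.
      rewrite -{1}(gtr0_norm ex) -normrM; congr `|_|; ring.
    have -> : expR (N * a) * `|h n a - g x| = `|expR (N * a) * h n a - g x * expR (N * a)|.
      rewrite -{1}(gtr0_norm ea) -normrM; congr `|_|; ring.
    have := ler_normD (expR (N * x) * h n x - g x * expR (N * x) -
        (expR (N * a) * h n a - g x * expR (N * a))) (expR (N * a) * h n a - g x * expR (N * a)).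
    rewrite subrK; nra.
  have gx0 : `|0 - g x| <= M by rewrite sub0r normrN gM.
  have [xr|xr] := leP (x - r / 2) 0.
    have aE : a = 0 by rewrite /a; apply/max_idPl.
    apply: nearW => n; rewrite sub0r normrN normr_id.
    apply: le_trans (key n) _; have [h0 _ _] := H n.
    rewrite aE h0; have gd : `|g 0 - g x| <= d / 2 by apply: rH => //; lra.
    have : expR (- (n.+1%:R * (x - 0))) <= 1 by rewrite -expR0 ler_expR oppr_le0 mulr_ge0// subr0.
    have := expR_ge0 (- (n.+1%:R * (x - 0))); have := normr_ge0 (g 0 - g x); nra.
  have aE : a = x - r / 2 by rewrite /a; apply/max_idPr/ltW.
  have aI : a \in `[0, 1] by rewrite in_itv/=; lra.
  near=> n; rewrite sub0r normrN normr_id; apply: le_trans (key n) _.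
  have ha : `|h n a - g x| <= 2 * M.
    by apply: le_trans (ler_normB _ _) _; have := hM n a aI; have := gM x xI; lra.
  rewrite aE subKr expRN; rewrite aE in ha.
  have nr : 4 * M / d / (r / 2) <= n%:R by near: n; exact: nbhs_infty_ger.
  have E1 : n%:R * (r / 2) <= expR (n.+1%:R * (r / 2)).
    apply: le_trans (expR_ge1Dx _). rewrite -(natr1 n) mulrDl; lra.
  have E2 : 4 * M / d <= expR (n.+1%:R * (r / 2)).
    by apply: le_trans E1; rewrite -ler_pdivrMr// divr_gt0.
  rewrite ler_pdivrMr// in E2.
  have ep := expR_gt0 (n.+1%:R * (r / 2)).
  have : (expR (n.+1%:R * (r / 2)))^-1 * `|h n (x - r / 2) - g x| <= d / 2.
    by rewrite mulrC ler_pdivrMr//; lra.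
  lra.
have := H1 1 one_in01; move/cvgrPdist_le => /(_ e e0)[n _ Hn].
exists (h n), (fun x => n.+1%:R * (g x - h n x)); split; first by have [] := H n.
have := Hn n (leqnn n); rewrite {1}/prim /Rintegral integral0 sub0r normrN.
exact: le_trans (ler_norm _).
Unshelve. all: by end_near. Qed.

Lemma L1_approx f (e : R) : L1_01 f -> 0 < e -> exists h h',
  AC_deriv h h' /\ prim (fun x => `|f x - h x|) 1 <= e.
Proof.
move=> Lf e0.
have mI : (mu (`[0%R, 1%R] : set R) < +oo)%E.
  by rewrite /= lebesgue_measure_itv/= lte_fin ltr01 -EFinD ltry.
have [g_ [cg Lg /fine_cvgP[_ gf]]] :=
  @approximation_continuous_integrable R `[0, 1] f (measurable_itv _) mI Lf.
move/cvgrPdist_le: gf => /(_ (e / 2) (divr_gt0 e0 _))[//|n _ Hn].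
have {Hn} := Hn n (leqnn n); rewrite sub0r normrN /= => /(le_trans (ler_norm _)) Hn.
have cg01 : cont01 (g_ n) by exact/cont01_continuous/cg.
have [h [h' [H hE]]] := continuous_L1_approx cg01 (divr_gt0 e0 (ltr0Sn _ 1)).
exists h, h'; split=> //.
have LB u v : L1_01 u -> L1_01 v -> L1_01 (fun x => `|u x - v x|).
  move=> Lu Lv; apply: L1_norm; apply: L1D => //.
  by apply: L1_ext (L1Z (-1) Lv) => x _; rewrite mulN1r.
have Lh := AC_L1 H; have Lg1 := cont01_L1 cg01.
have aS := AC_prim (L1D (LB _ _ Lf Lg1) (LB _ _ Lg1 Lh)).
have aT := ACD (AC_prim (LB _ _ Lf Lg1)) (AC_prim (LB _ _ Lg1 Lh)).
have : prim (fun x => `|f x - h x|) 1 - prim (fun x => `|f x - h x|) 0 <=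
  (prim (fun x => `|f x - g_ n x|) 1 + prim (fun x => `|g_ n x - h x|) 1) -
  (prim (fun x => `|f x - g_ n x|) 0 + prim (fun x => `|g_ n x - h x|) 0).
  apply: le_trans (ler_norm _) _.
  apply: (AC_norm_le (AC_prim (LB _ _ Lf Lh)) aT) => // x _.
  by rewrite normr_id -[f x - h x](subrKA (g_ n x)) ler_normD.
rewrite !prim0 subr0 addr0 subr0 => /le_trans; apply.
by rewrite [e]splitr lerD.
Qed.

(** The oscillating factor is represented by t, together with a primitive s of
size 1 / k, which covers sines and cosines at once.  After approximation by an
absolutely continuous h, integration by parts moves the derivative to h. *)
Lemma riemann_lebesgue f (e : R) : L1_01 f -> 0 < e -> exists2 K : R, 0 < K &
  forall k s t, K <= k -> AC_deriv s t -> cont01 t ->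
    (forall x, x \in `[0, 1] -> `|s x| <= k^-1) ->
    (forall x, x \in `[0, 1] -> `|t x| <= 1) ->
    `|prim (fun x => f x * t x) 1| <= e.
Proof.
move=> Lf e0; have [h [h' [H hf]]] := L1_approx Lf (divr_gt0 e0 (ltr0Sn R 1)).
have aV := AC_prim (L1_norm H.1); set V := prim _ in aV.
have V0 : V 0 = 0 by rewrite /V prim0.
have V1 : 0 <= V 1 by apply: Rintegral_ge0 => x _.
pose B := `|h 1| + `|h 0| + V 1.
have B0 : 0 <= B by rewrite !addr_ge0.
exists (2 * B / e + 1) => [|k s t Kk S ct sk t1].
  by rewrite ltr_wpDl// divr_ge0 ?mulr_ge0// ltW.
have BE : 0 <= 2 * B / e by rewrite divr_ge0 ?mulr_ge0// ltW.
have k0 : 0 < k by lra.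
have Bk : B / k <= e / 2.
  have : 2 * B / e <= k by lra.
  by rewrite ler_pdivrMr// => ?; rewrite ler_pdivrMr//; lra.
have LB : L1_01 (fun x => `|f x - h x|).
  apply: L1_norm; apply: L1D => //.
  by apply: L1_ext (L1Z (-1) (AC_L1 H)) => x _; rewrite mulN1r.
have aft := AC_prim (L1M Lf ct); have aht := AC_prim (L1M (AC_L1 H) ct).
have P1 : `|prim (fun x => f x * t x) 1 - prim (fun x => h x * t x) 1| <= e / 2.
  have := AC_norm_le (ACB aft aht) (AC_prim LB) (lexx 0) ler01 (lexx 1).
  rewrite !prim0 !subr0 => L; apply: le_trans (L _) hf => x xI.
  have xI' : x \in `[0, 1] by rewrite in_itv.
  rewrite -mulrBl normrM -[leRHS]mulr1 ler_wpM2l// t1//.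
have P2 : `|(h 1 * s 1 - prim (fun x => h x * t x) 1) - (h 0 * s 0 - prim (fun x => h x * t x) 0)| <=
    k^-1 * V 1 - k^-1 * V 0.
  apply: (AC_norm_le (ACB (ACM H S) aht) (ACZ k^-1 aV)) => // x xI.
  have xI' : x \in `[0, 1] by rewrite in_itv.
  rewrite addrK normrM mulrC ler_wpM2r// sk//.
rewrite prim0 V0 mulr0 !subr0 in P2.
have S1 : `|h 1 * s 1| <= `|h 1| * k^-1 by rewrite normrM ler_wpM2l// sk// one_in01.
have S0 : `|h 0 * s 0| <= `|h 0| * k^-1 by rewrite normrM ler_wpM2l// sk// zero_in01.
have P3 : `|prim (fun x => h x * t x) 1| <= B / k.
  move: P2 S1 S0; rewrite /B !ler_norml => ? ? ?; apply/andP; split; lra.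
have := ler_normD (prim (fun x => f x * t x) 1 - prim (fun x => h x * t x) 1)
  (prim (fun x => h x * t x) 1); rewrite subrK; lra.
Qed.

End RiemannLebesgue.

(** * Large eigenvalues determine the mean *)

Section Asymptotics.
Context {R : realType}.
Implicit Types f g h u v w y : R -> R.

Variable q : R -> R.
Hypothesis Lq : L1_01 q.

(** Amplitudes of variation of constants: u = A cos(k x) + B sin(k x) and
u' = k (- A sin(k x) + B cos(k x)) with A = amp_cos and B = amp_sin. *)
Definition amp_cos (k : R) u u1 x := u x * cos (k * x) - u1 x / k * sin (k * x).
Definition amp_sin (k : R) u u1 x := u x * sin (k * x) + u1 x / k * cos (k * x).

Lemma amp_recover k u u1 x :
  u x = amp_cos k u u1 x * cos (k * x) + amp_sin k u u1 x * sin (k * x).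
Proof.
rewrite /amp_cos /amp_sin; transitivity (u x * (cos (k * x) ^+ 2 + sin (k * x) ^+ 2)).
  by rewrite cos2Dsin2 mulr1.
ring.
Qed.

Lemma AC_amp_cos k u u1 : k != 0 -> solves q (k ^+ 2) u u1 ->
  AC_deriv (amp_cos k u u1) (fun x => - (q x * u x * sin (k * x)) / k).
Proof.
move=> k0 [U U1]; have H := ACB (ACM U (AC_cos k)) (ACM (ACZ k^-1 U1) (AC_sin k)).
by apply: eq_AC H => x _; rewrite /amp_cos; field.
Qed.

Lemma AC_amp_sin k u u1 : k != 0 -> solves q (k ^+ 2) u u1 ->
  AC_deriv (amp_sin k u u1) (fun x => q x * u x * cos (k * x) / k).
Proof.
move=> k0 [U U1]; have H := ACD (ACM U (AC_sin k)) (ACM (ACZ k^-1 U1) (AC_cos k)).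
by apply: eq_AC H => x _; rewrite /amp_sin; field.
Qed.

Let V := prim (fun x => `|q x|).
Let aV : AC_deriv V (fun x => `|q x|). Proof. exact/AC_prim/L1_norm. Qed.
Let V0 : V 0 = 0. Proof. exact: prim0. Qed.
Let W := V 1.
Let W0 : 0 <= W. Proof. by apply: Rintegral_ge0 => x _. Qed.

Let normM_le (a b : R) : `|b| <= 1 -> `|a * b| <= `|a|.
Proof. by move=> b1; rewrite normrM ler_piMr. Qed.

Let cos1 (x : R) : `|cos x| <= 1.
Proof. by rewrite ler_norml cos_geN1 cos_le1. Qed.

Let sin1 (x : R) : `|sin x| <= 1.
Proof. by rewrite ler_norml sin_geN1 sin_le1. Qed.

Lemma amp_drift k u u1 E : 0 < k -> solves q (k ^+ 2) u u1 ->
  (forall x, x \in `[0, 1] -> `|u x| <= E) ->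
  forall x, x \in `[0, 1] ->
    `|amp_cos k u u1 x - amp_cos k u u1 0| <= W * E / k /\
    `|amp_sin k u u1 x - amp_sin k u u1 0| <= W * E / k.
Proof.
move=> k0 U uE x; rewrite in_itv/= => /andP[x0 x1].
have kn : k != 0 by rewrite gt_eqF.
have E0 : 0 <= E / k.
  by apply: divr_ge0 (ltW k0); exact: le_trans (normr_ge0 _) (uE 0 zero_in01).
have VW : E / k * V x - E / k * V 0 <= W * E / k.
  rewrite V0 mulr0 subr0 (_ : W * E / k = E / k * W); last by ring.
  by rewrite ler_wpM2l//; apply: (AC_le aV).
have bnd (b s : R) : 0 <= s <= x -> `|b| <= 1 -> `|q s * u s * b / k| <= E / k * `|q s|.
  move=> sx b1; have sI : s \in `[0, 1] by rewrite in_itv/=; lra.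
  rewrite (_ : _ / k = q s * (u s * b / k)); last by ring.
  rewrite normrM mulrC ler_wpM2r// normrM normfV (gtr0_norm k0).
  rewrite ler_pM2r ?invr_gt0//. exact: le_trans (normM_le _ b1) (uE s sI).
split; apply: le_trans VW.
  apply: (AC_norm_le (AC_amp_cos kn U) (ACZ (E / k) aV)) => // s sx.
  by rewrite mulNr normrN; exact: bnd.
by apply: (AC_norm_le (AC_amp_sin kn U) (ACZ (E / k) aV)) => // s sx; exact: bnd.
Qed.

Let tc k x : R := cos (k * x) * cos (k * x) - sin (k * x) * sin (k * x).
Let ts k x : R := 2 * (sin (k * x) * cos (k * x)).

Let tcP k : 0 < k -> exists s, [/\ AC_deriv s (tc k), cont01 (tc k),
  forall x, x \in `[0, 1] -> `|s x| <= k^-1 & forall x, x \in `[0, 1] -> `|tc k x| <= 1].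
Proof.
move=> k0; have aC := AC_cos k; have aS := AC_sin k.
exists (fun x => k^-1 * (sin (k * x) * cos (k * x))); split.
- by apply: eq_AC (ACZ k^-1 (ACM aS aC)) => x _ //; rewrite /tc; field; rewrite gt_eqF.
- exact: AC_cont (ACB (ACM aC aC) (ACM aS aS)).
- move=> x _; rewrite normrM gtr0_norm ?invr_gt0// ler_piMr ?invr_ge0 ?(ltW k0)//.
  exact: le_trans (normM_le _ (cos1 _)) (sin1 _).
- by move=> x _; rewrite /tc -cosD; exact: cos1.
Qed.

Let tsP k : 0 < k -> exists s, [/\ AC_deriv s (ts k), cont01 (ts k),
  forall x, x \in `[0, 1] -> `|s x| <= k^-1 & forall x, x \in `[0, 1] -> `|ts k x| <= 1].
Proof.
move=> k0; have aC := AC_cos k; have aS := AC_sin k.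
exists (fun x => k^-1 * (sin (k * x) * sin (k * x))); split.
- by apply: eq_AC (ACZ k^-1 (ACM aS aS)) => x _ //; rewrite /ts; field; rewrite gt_eqF.
- exact: AC_cont (ACZ 2 (ACM aS aC)).
- move=> x _; rewrite normrM gtr0_norm ?invr_gt0// ler_piMr ?invr_ge0 ?(ltW k0)//.
  exact: le_trans (normM_le _ (sin1 _)) (sin1 _).
- move=> x _; rewrite /ts (_ : _ * _ = sin (k * x + k * x)) ?sin1//.
  by rewrite sinD; ring.
Qed.

Let Q := prim q 1.
Let cq k := prim (fun x => q x * tc k x) 1.
Let sq k := prim (fun x => q x * ts k x) 1.


(** A function F with derivative q r, where r is p plus oscillations of frequency
2 k up to th, has increment p int q plus Fourier coefficients of q up to th W. *)
Lemma mean_balance k F (r : R -> R) (p b c th : R) : 0 < k -> AC_deriv F (fun x => q x * r x) ->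
  (forall x, x \in `[0, 1] -> `|r x - (p + b * tc k x + c * ts k x)| <= th) ->
  `|p * Q + b * cq k + c * sq k| <= `|F 1 - F 0| + th * W.
Proof.
move=> k0 aF rth; have [_ [_ ct _ _]] := tcP k0; have [_ [_ cs _ _]] := tsP k0.
have aG := ACD (ACD (ACZ p (AC_prim Lq)) (ACZ b (AC_prim (L1M Lq ct))))
  (ACZ c (AC_prim (L1M Lq cs))).
have := AC_norm_le (ACB aF aG) (ACZ th aV) (lexx 0) ler01 (lexx 1).
rewrite V0 !prim0 -/Q -/(cq k) -/(sq k) -/W => L.
have {}L : `|F 1 - (p * Q + b * cq k + c * sq k) - (F 0 - (p * 0 + b * 0 + c * 0))|
    <= th * W - th * 0.
  apply: L => x xI; have xI' : x \in `[0, 1] by rewrite in_itv.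
  rewrite (_ : _ - _ = (r x - (p + b * tc k x + c * ts k x)) * q x); last by ring.
  by rewrite normrM ler_wpM2r// rth.
move: L; have := ler_norm (F 1 - F 0); have := ler_norm (- (F 1 - F 0)).
rewrite normrN !ler_norml => ? ? /andP[? ?]; apply/andP; split; lra.
Qed.

Let scale_le (p r C S : R) : `|C| <= 1 -> `|S| <= 1 -> `|p * C + r * S| <= `|p| + `|r|.
Proof.
move=> C1 S1; apply: le_trans (ler_normD _ _) _.
by apply: lerD; exact: normM_le.
Qed.

Section pair.
Variables (k : R) (u u1 v v1 : R -> R).
Hypotheses (k0 : 0 < k) (U : solves q (k ^+ 2) u u1) (U' : solves q (k ^+ 2) v v1).
Let A := amp_cos k u u1.
Let B := amp_sin k u u1.
Let A' := amp_cos k v v1.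
Let B' := amp_sin k v v1.

Let kn : k != 0. Proof. by rewrite gt_eqF. Qed.
Let aA : AC_deriv A (fun x => - (q x * u x * sin (k * x)) / k).
Proof. exact: AC_amp_cos. Qed.
Let aB : AC_deriv B (fun x => q x * u x * cos (k * x) / k).
Proof. exact: AC_amp_sin. Qed.
Let aA' : AC_deriv A' (fun x => - (q x * v x * sin (k * x)) / k).
Proof. exact: AC_amp_cos. Qed.
Let aB' : AC_deriv B' (fun x => q x * v x * cos (k * x) / k).
Proof. exact: AC_amp_sin. Qed.

Definition amp_size (x : R) := `|A x| + `|B x| + (`|A' x| + `|B' x|).

(** If E bounds the amplitudes on [0, 1], they move by at most W E / k <= E / 8,
hence E is at most twice their size at 0. *)
Lemma amp_stability : 8 * W <= k ->
  (exists2 x, x \in `[0, 1] & (u x != 0) || (v x != 0)) ->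
  0 < amp_size 0 /\ exists eta, [/\ 0 <= eta, eta * k <= 2 * W * amp_size 0,
    forall x, x \in `[0, 1] -> `|A x - A 0| <= eta /\ `|B x - B 0| <= eta &
    forall x, x \in `[0, 1] -> `|A' x - A' 0| <= eta /\ `|B' x - B' 0| <= eta].
Proof.
move=> kW nz.
have cn f g : AC_deriv f g -> cont01 (fun x => `|f x|).
  by move=> /AC_cont cf x; apply: continuous_comp; [exact: cf|exact: norm_continuous].
have cN : cont01 amp_size.
  by apply: cont01D; apply: cont01D; apply: cn; eassumption.
have [xm xmI NE] := EVT_max ler01 cN; set E := amp_size xm in NE.
have uE x : x \in `[0, 1] -> `|u x| <= E.
  move=> /NE; apply: le_trans; rewrite (amp_recover k u u1 x) /amp_size.
  by apply: le_trans (scale_le _ _ (cos1 _) (sin1 _)) _; rewrite lerDl addr_ge0.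
have vE x : x \in `[0, 1] -> `|v x| <= E.
  move=> /NE; apply: le_trans; rewrite (amp_recover k v v1 x) /amp_size.
  by apply: le_trans (scale_le _ _ (cos1 _) (sin1 _)) _; rewrite lerDr addr_ge0.
have du x (xI : x \in `[0, 1]) := amp_drift k0 U uE xI.
have dv x (xI : x \in `[0, 1]) := amp_drift k0 U' vE xI.
rewrite -/A -/B -/A' -/B' in du dv.
have E0 : 0 <= E by rewrite /E /amp_size !addr_ge0.
set eta := W * E / k in du dv.
have eta8 : eta <= E / 8 by rewrite /eta ler_pdivrMr//; nra.
have EN0 : E <= 2 * amp_size 0.
  have [Ha Hb] := du xm xmI; have [Hc Hd] := dv xm xmI.
  have Ta := ler_normD (A xm - A 0) (A 0); have Tb := ler_normD (B xm - B 0) (B 0).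
  have Tc := ler_normD (A' xm - A' 0) (A' 0); have Td := ler_normD (B' xm - B' 0) (B' 0).
  rewrite !subrK in Ta Tb Tc Td.
  have EE : E = `|A xm| + `|B xm| + (`|A' xm| + `|B' xm|) by [].
  by rewrite /amp_size; lra.
split; last first.
  exists eta; split=> //; first by rewrite divr_ge0 ?mulr_ge0// ltW.
  by rewrite /eta divfK// [2 * W]mulrC -mulrA ler_wpM2l.
rewrite ltNge; apply/negP => N00; have [x xI] := nz.
have E00 : E <= 0 by lra.
have /eqP -> : u x == 0 by rewrite -normr_le0; exact: le_trans (uE x xI) E00.
have /eqP -> : v x == 0 by rewrite -normr_le0; exact: le_trans (vE x xI) E00.
by rewrite eqxx.
Qed.

(** Here a B - b A + c B' - d A' has derivative
q (u (a cos + b sin) + v (c cos + d sin)) / k; replacing the amplitudes in u and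
v by their initial values leaves a constant term and terms of frequency 2 k. *)
Lemma amp_balance (a b c d eta : R) :
  (forall x, x \in `[0, 1] -> `|A x - A 0| <= eta /\ `|B x - B 0| <= eta) ->
  (forall x, x \in `[0, 1] -> `|A' x - A' 0| <= eta /\ `|B' x - B' 0| <= eta) ->
  (forall x : R, `|a * cos x + b * sin x| <= 1) ->
  (forall x : R, `|c * cos x + d * sin x| <= 1) ->
  a * B 1 - b * A 1 + c * B' 1 - d * A' 1 = a * B 0 - b * A 0 + c * B' 0 - d * A' 0 ->
  `|(a * A 0 + b * B 0 + c * A' 0 + d * B' 0) * Q +
    (a * A 0 - b * B 0 + c * A' 0 - d * B' 0) * cq k +
    (a * B 0 + b * A 0 + c * B' 0 + d * A' 0) * sq k| <= 8 * eta * W.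
Proof.
move=> dA dA' ab cd bc.
have F : AC_deriv (fun x => k * (a * B x - b * A x + c * B' x - d * A' x))
    (fun x => q x * (u x * (a * cos (k * x) + b * sin (k * x)) +
                     v x * (c * cos (k * x) + d * sin (k * x)))).
  have H := ACB (ACD (ACB (ACZ a aB) (ACZ b aA)) (ACZ c aB')) (ACZ d aA').
  by apply: eq_AC (ACZ k H) => x _ //; field.
have := mean_balance k0 F (th := 4 * eta)
  (p := (a * A 0 + b * B 0 + c * A' 0 + d * B' 0) / 2)
  (b := (a * A 0 - b * B 0 + c * A' 0 - d * B' 0) / 2)
  (c := (a * B 0 + b * A 0 + c * B' 0 + d * A' 0) / 2) _.
rewrite bc subrr normr0 add0r => M.
rewrite (_ : _ + _ = 2 * ((a * A 0 + b * B 0 + c * A' 0 + d * B' 0) / 2 * Q +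
  (a * A 0 - b * B 0 + c * A' 0 - d * B' 0) / 2 * cq k +
  (a * B 0 + b * A 0 + c * B' 0 + d * A' 0) / 2 * sq k)); last by field.
rewrite normrM (ger0_norm (ler0n _ 2)) (_ : 8 * eta * W = 2 * (4 * eta * W)); last by ring.
rewrite ler_pM2l//; apply: M => x xI.
set C := cos (k * x); set S := sin (k * x).
have osc : C ^+ 2 + S ^+ 2 = 1 by exact: cos2Dsin2.
have CC : C * C = (1 + tc k x) / 2.
  by rewrite /tc -/C -/S; move: osc; rewrite !expr2; lra.
have SS : S * S = (1 - tc k x) / 2.
  by rewrite /tc -/C -/S; move: osc; rewrite !expr2; lra.
have SC : S * C = ts k x / 2 by rewrite /ts -/C -/S; field.
have [d1 d2] := dA x xI; have [d3 d4] := dA' x xI.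
pose X := a * C + b * S; pose Y := c * C + d * S.
have X1 : `|X| <= 1 by exact: ab.
have Y1 : `|Y| <= 1 by exact: cd.
rewrite (_ : _ - _ = ((A x - A 0) * C + (B x - B 0) * S) * X +
  ((A' x - A' 0) * C + (B' x - B' 0) * S) * Y).
  apply: le_trans (scale_le _ _ X1 Y1) _.
  have := scale_le (A x - A 0) (B x - B 0) (cos1 (k * x)) (sin1 (k * x)).
  have := scale_le (A' x - A' 0) (B' x - B' 0) (cos1 (k * x)) (sin1 (k * x)).
  by rewrite -/C -/S; lra.
rewrite (amp_recover k u u1 x) (amp_recover k v v1 x) -/(A x) -/(B x) -/(A' x) -/(B' x) -/C -/S.
transitivity ((A x * C + B x * S) * X + (A' x * C + B' x * S) * Y -
  ((a * A 0 + c * A' 0) * (C * C) + (b * B 0 + d * B' 0) * (S * S) +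
   (a * B 0 + b * A 0 + c * B' 0 + d * A' 0) * (S * C))); last by rewrite /X /Y; ring.
by rewrite CC SS SC /X /Y; field.
Qed.

Lemma amp_boundary t : cos k = cos t -> sin k = sin t ->
  u 1 = cos t * u 0 - sin t * v 0 /\ v 1 = sin t * u 0 + cos t * v 0 ->
  u1 1 = cos t * u1 0 - sin t * v1 0 /\ v1 1 = sin t * u1 0 + cos t * v1 0 ->
  let c := cos t in let s := sin t in
  [/\ A 1 = (c * A 0 - s * A' 0) * c - (c * B 0 - s * B' 0) * s,
      B 1 = (c * A 0 - s * A' 0) * s + (c * B 0 - s * B' 0) * c,
      A' 1 = (s * A 0 + c * A' 0) * c - (s * B 0 + c * B' 0) * s &
      B' 1 = (s * A 0 + c * A' 0) * s + (s * B 0 + c * B' 0) * c].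
Proof.
move=> ck sk [bu bv] [bu1 bv1] c s.
have amp0 w w1 : w 0 = amp_cos k w w1 0 /\ w1 0 = k * amp_sin k w w1 0.
  rewrite /amp_cos /amp_sin mulr0 cos0 sin0. by split; field.
have [u0E u10E] := amp0 u u1; have [v0E v10E] := amp0 v v1.
rewrite -/A -/B -/A' -/B' in u0E u10E v0E v10E.
rewrite u0E v0E in bu bv; rewrite u10E v10E in bu1 bv1.
split.
- by rewrite /c /s [LHS]/A /amp_cos mulr1 ck sk bu bu1; field.
- by rewrite /c /s [LHS]/B /amp_sin mulr1 ck sk bu bu1; field.
- by rewrite /c /s [LHS]/A' /amp_cos mulr1 ck sk bv bv1; field.
- by rewrite /c /s [LHS]/B' /amp_sin mulr1 ck sk bv bv1; field.
Qed.

End pair.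

(** For c = cos t and s = sin t, the displacement (X - x, Y - y) is the image of
(x, y) by the rotation of angle 2 t minus the identity, whose inverse has norm
1 / (2 |sin t|). *)
Lemma reflected_amplitude_small (c s x y X Y e : R) : c ^+ 2 + s ^+ 2 = 1 ->
  X - x = (c ^+ 2 - s ^+ 2 - 1) * x - 2 * s * c * y ->
  Y - y = 2 * s * c * x + (c ^+ 2 - s ^+ 2 - 1) * y ->
  `|X - x| <= 2 * e -> `|Y - y| <= 2 * e -> `|s| * `|x| <= 2 * e /\ `|s| * `|y| <= 2 * e.
Proof.
move=> cs; set dX := X - x; set dY := Y - y => dXE dYE X1 Y1.
have c2 : c ^+ 2 = 1 - s ^+ 2 by lra.
have n2 (z : R) : `|2 * z| = 2 * `|z| by rewrite normrM (ger0_norm (ler0n _ 2)).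
have c1 : `|c| <= 1 by rewrite -(@ler_pXn2r _ 2) ?nnegrE// expr1n real_normK ?num_real//; have := sqr_ge0 s; lra.
have s1 : `|s| <= 1 by rewrite -(@ler_pXn2r _ 2) ?nnegrE// expr1n real_normK ?num_real//; have := sqr_ge0 c; lra.
have E1 : 2 * (s * x) = dX * - s + dY * c.
  transitivity (2 * (s * x) * (s ^+ 2 + c ^+ 2)); first by rewrite addrC cs mulr1.
  by rewrite dXE dYE; ring: c2.
have E2 : 2 * (s * y) = dX * - c + dY * - s.
  transitivity (2 * (s * y) * (s ^+ 2 + c ^+ 2)); first by rewrite addrC cs mulr1.
  by rewrite dXE dYE; ring: c2.
split.
  by have := scale_le dX dY (_ : `|- s| <= 1) c1; rewrite normrN -E1 n2 normrM => /(_ s1); lra.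
by have := scale_le dX dY (_ : `|- c| <= 1) (_ : `|- s| <= 1); rewrite !normrN -E2 n2 normrM => /(_ c1 s1); lra.
Qed.

(** (a1, a2) and (b1, b2) below are twice the initial coefficients of exp(ikx) and
exp(-ikx) in the eigenfunction.  The first is invariant under the boundary
condition, which gives two balances.  The second is invariant when sin t = 0,
and O(1/k) otherwise. *)
Lemma mean_bound t : exists2 K, 0 <= K & forall k u u1 v v1, 0 < k -> 8 * W <= k ->
  cos k = cos t -> sin k = sin t -> real_eigenpair q t (k ^+ 2) u u1 v v1 ->
  `|Q| <= `|cq k| + `|sq k| + K / k.
Proof.
exists (64 * W ^+ 2 + 8 * W ^+ 2 / `|sin t|).
  by rewrite addr_ge0 ?divr_ge0 ?mulr_ge0 ?sqr_ge0.
move=> k u u1 v v1 k0 kW ck sk [U U' bc bc1 nz].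
have [N0 [eta [eta0 etak dA dA']]] := amp_stability k0 U U' kW nz.
have [] := amp_boundary k0 ck sk bc bc1.
have bal a b c d := @amp_balance k u u1 v v1 k0 U U' a b c d eta dA dA'.
set N := amp_size _ _ _ _ _ 0 in N0 etak.
have NE : N = `|amp_cos k u u1 0| + `|amp_sin k u u1 0| +
  (`|amp_cos k v v1 0| + `|amp_sin k v v1 0|) by [].
have [dA1 dB1] := dA 1 one_in01; have [dA1' dB1'] := dA' 1 one_in01.
move: bal NE dA1 dB1 dA1' dB1'; rewrite /= {dA dA'}; clearbody N.
move: (amp_cos k u u1) (amp_sin k u u1) (amp_cos k v v1) (amp_sin k v v1).
move=> A B A' B' bal NE dA dB dA' dB'.
set c := cos t; set s := sin t => A1 B1 A1' B1'.
have cs : c ^+ 2 + s ^+ 2 = 1 by exact: cos2Dsin2.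
have c2 : c ^+ 2 = 1 - s ^+ 2 by lra.
pose a1 := A 0 + B' 0; pose a2 := A' 0 - B 0.
pose b1 := A 0 - B' 0; pose b2 := A' 0 + B 0.
pose Sg := `|a1| + `|a2| + (`|b1| + `|b2|).
have NS : N <= Sg.
  have half (x y : R) : `|(x + y) / 2| <= (`|x| + `|y|) / 2.
    by rewrite normrM [`|2^-1|]gtr0_norm ?invr_gt0// ler_wpM2r// ler_normD.
  have := half a1 b1; have := half a1 (- b1); have := half a2 b2; have := half b2 (- a2).
  rewrite !normrN NE /Sg.
  have -> : (a1 + b1) / 2 = A 0 by rewrite /a1 /b1; field.
  have -> : (a1 - b1) / 2 = B' 0 by rewrite /a1 /b1; field.
  have -> : (a2 + b2) / 2 = A' 0 by rewrite /a2 /b2; field.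
  have -> : (b2 - a2) / 2 = B 0 by rewrite /a2 /b2; field.
  lra.
have mono (a b d e p g r : R) :
    (forall x : R, `|a * cos x + b * sin x| <= 1) ->
    (forall x : R, `|d * cos x + e * sin x| <= 1) ->
    a * B 1 - b * A 1 + d * B' 1 - e * A' 1 = a * B 0 - b * A 0 + d * B' 0 - e * A' 0 ->
    a * A 0 + b * B 0 + d * A' 0 + e * B' 0 = p ->
    a * A 0 - b * B 0 + d * A' 0 - e * B' 0 = g ->
    a * B 0 + b * A 0 + d * B' 0 + e * A' 0 = r ->
    `|p| * `|Q| <= `|g| * `|cq k| + `|r| * `|sq k| + 8 * eta * W.
  move=> ab de bde <- <- <-; have := bal a b d e ab de bde.
  set p' := _ + e * B' 0; set g' := _ - e * B' 0; set r' := _ + e * A' 0 => H.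
  rewrite -!normrM.
  rewrite [p' * Q](_ : _ = (p' * Q + g' * cq k + r' * sq k) - (g' * cq k + r' * sq k)); last by ring.
  apply: le_trans (ler_normB _ _) _.
  by have := ler_normD (g' * cq k) (r' * sq k); lra.
have pS (x : R) : `|0 * cos x + 1 * sin x| <= 1 by rewrite mul0r add0r mul1r.
have pC (x : R) : `|1 * cos x + 0 * sin x| <= 1 by rewrite mul0r addr0 mul1r.
have mS (x : R) : `|0 * cos x + -1 * sin x| <= 1 by rewrite mul0r add0r mulN1r normrN.
have H1 : `|a1| * `|Q| <= `|b1| * `|cq k| + `|b2| * `|sq k| + 8 * eta * W.
  by apply: (mono _ _ _ _ _ _ _ pC pS); rewrite /a1 /b1 /b2 ?A1 ?B1 ?A1' ?B1'; ring: c2.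
have H2 : `|a2| * `|Q| <= `|b2| * `|cq k| + `|- b1| * `|sq k| + 8 * eta * W.
  by apply: (mono _ _ _ _ _ _ _ mS pC); rewrite /a2 /b1 /b2 ?A1 ?B1 ?A1' ?B1'; ring: c2.
rewrite normrN in H2.
have QW : `|Q| <= W.
  have := AC_norm_le (AC_prim Lq) aV (lexx 0) ler01 (lexx 1).
  by rewrite prim0 V0 !subr0; apply=> x _.
have rho0 : 0 <= (`|a1| + `|a2|) * (`|cq k| + `|sq k|) by rewrite mulr_ge0 ?addr_ge0.
have eW : 0 <= eta * W by rewrite mulr_ge0.
have eWs : 0 <= eta * W / `|s| by rewrite divr_ge0.
have bQ : (`|b1| + `|b2|) * `|Q| <=
    (`|a1| + `|a2|) * (`|cq k| + `|sq k|) + 16 * (eta * W) + 4 * (eta * W / `|s|).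
  have [s0|s0] := eqVneq s 0.
    have H3 : `|b2| * `|Q| <= `|a2| * `|cq k| + `|a1| * `|sq k| + 8 * eta * W.
      by apply: (mono _ _ _ _ _ _ _ pS pC); rewrite /a1 /a2 /b2 ?A1 ?B1 ?A1' ?B1' ?s0;
        rewrite s0 expr0n subr0 in c2; ring: c2.
    have H4 : `|b1| * `|Q| <= `|a1| * `|cq k| + `|- a2| * `|sq k| + 8 * eta * W.
      by apply: (mono _ _ _ _ _ _ _ pC mS); rewrite /a1 /a2 /b1 ?A1 ?B1 ?A1' ?B1' ?s0;
        rewrite s0 expr0n subr0 in c2; ring: c2.
    rewrite normrN in H4; move: eWs H3 H4; lra.
  pose X := A 1 - B' 1; pose Y := A' 1 + B 1.
  have [] := @reflected_amplitude_small c s b1 b2 X Y eta cs.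
  - by rewrite /X A1 B1' /b1 /b2; ring.
  - by rewrite /Y B1 A1' /b1 /b2; ring.
  - rewrite /X /b1 (_ : _ - _ = (A 1 - A 0) - (B' 1 - B' 0)); last by ring.
    by apply: le_trans (ler_normB _ _) _; rewrite mulr_natl mulr2n lerD.
  - rewrite /Y /b2 (_ : _ - _ = (A' 1 - A' 0) + (B 1 - B 0)); last by ring.
    by apply: le_trans (ler_normD _ _) _; rewrite mulr_natl mulr2n lerD.
  have sp : 0 < `|s| by rewrite normr_gt0.
  move=> sx sy.
  have : (`|b1| + `|b2|) * `|Q| <= 4 * (eta * W / `|s|).
    rewrite (_ : 4 * _ = 4 * eta / `|s| * W); last by field; rewrite gt_eqF.
    apply: ler_pM; rewrite ?addr_ge0//.
    by rewrite ler_pdivlMr//; move: sx sy; lra.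
  by move: rho0 eW; lra.
have main : Sg * `|Q| <= Sg * (`|cq k| + `|sq k|) + eta * (32 * W + 4 * W / `|s|).
  rewrite (_ : eta * _ = 32 * (eta * W) + 4 * (eta * W / `|s|)); last by set z := `|s|^-1; ring.
  by move: H1 H2 bQ; rewrite /Sg; lra.
have Sg0 : 0 < Sg by apply: lt_le_trans NS.
have Cs : 0 <= 32 * W + 4 * W / `|s| by rewrite addr_ge0 ?divr_ge0 ?mulr_ge0.
have eS : eta <= 2 * W * Sg / k.
  by rewrite ler_pdivlMr//; apply: le_trans etak _; rewrite ler_wpM2l ?mulr_ge0.
rewrite -(ler_pM2l Sg0) mulrDr; apply: le_trans main _; rewrite lerD2l.
apply: le_trans (ler_wpM2r Cs eS) _.
rewrite le_eqVlt; apply/orP; left; apply/eqP.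
by set z := `|s|^-1; field; rewrite gt_eqF.
Qed.

Lemma frequency_period (t : R) (n : nat) :
  cos (2 * n%:R * pi + t) = cos t /\ sin (2 * n%:R * pi + t) = sin t.
Proof.
have -> : 2 * n%:R * pi + t = t + (pi *+ 2) *+ n.
  by rewrite addrC -mulr_natl -[_ *+ n]mulr_natl; ring.
split; first by rewrite (periodicn (@cosD2pi R)).
by rewrite (periodicn (@sinD2pi R)).
Qed.

Lemma mean_eq0 (t : R) (n0 : nat) : 0 <= t ->
  (forall n : nat, (n0 < n)%N -> eigenvalue_L q t ((2 * n%:R * pi + t) ^+ 2)) ->
  prim q 1 = 0.
Proof.
move=> t0 H; have [K K0 HK] := mean_bound t.
suff : forall e : R, 0 < e -> `|Q| <= e.
  move=> He; apply/eqP; rewrite -normr_eq0 eq_le normr_ge0 andbT leNgt.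
  apply/negP => Q0; have := He (`|Q| / 2) (divr_gt0 Q0 (ltr0Sn _ 1)); rewrite /Q in Q0 *; lra.
move=> e e0; have e4 : 0 < e / 4 by rewrite divr_gt0.
have [M M0 HM] := riemann_lebesgue Lq e4.
pose X := M + 8 * W + 2 * K / e + n0%:R + 1.
have Ke : 0 <= 2 * K / e by rewrite divr_ge0 ?mulr_ge0// ltW.
have X0 : 0 <= X by rewrite /X !addr_ge0// ?mulr_ge0// ltW.
have := archi_boundP X0; set n := Num.bound X => nX.
have nn0 : (n0 < n)%N.
  by rewrite -(ltr_nat R); rewrite /X in nX; have := W0; have := ltW M0; lra.
pose k := 2 * n%:R * pi + t.
have kn : n%:R <= k.
  have : 0 <= n%:R * (2 * pi - 1) :> R by rewrite mulr_ge0//; have := pi_ge2 R; lra.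
  by rewrite /k; lra.
have n0R := ler0n R n0; have Wge0 := W0.
have k0 : 0 < k by rewrite /X in nX; lra.
have [ck sk] := frequency_period t n.
have := H n nn0 => /(eigenvalue_realP Lq)[u [u1 [v [v1 P]]]].
have kW : 8 * W <= k by rewrite /X in nX; lra.
have B := HK k _ _ _ _ k0 kW ck sk P.
have Mk : M <= k by rewrite /X in nX; lra.
have [sc [c1 c2 c3 c4]] := tcP k0; have [ss [s1 s2 s3 s4]] := tsP k0.
have := HM k _ _ Mk c1 c2 c3 c4; have := HM k _ _ Mk s1 s2 s3 s4.
rewrite -/(cq k) -/(sq k).
have : K / k <= e / 2.
  have : 2 * K / e <= k by rewrite /X in nX; lra.
  by rewrite ler_pdivrMr// => ?; rewrite ler_pdivrMr//; lra.
lra.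
Qed.

End Asymptotics.

(** The value lambda n is attained, so its eigenspace has positive dimension; the
first basis vector cannot vanish on [0, 1] by linear independence. *)
Lemma labelled_eigenvalue (R : realType) (q : R -> R) (t : R) (lambda : int -> R) n :
  eigenvalue_labelling q t lambda -> eigenvalue_L q t (lambda n).
Proof.
move=> [Hdim _]; have [d [e [Ve free _]]] := Hdim (lambda n).
case: d e Ve free => [|d] e Ve free card.
  have S0 : [set m | lambda m = lambda n] = set0.
    by apply/eqP; rewrite -(@card_eq0 _ nat) -II0.
  by have : [set m | lambda m = lambda n] n by []; rewrite S0.
have [[x xI ex]|ne] := pselect (exists2 x, x \in `[0, 1] & e ord0 x != 0).
  by exists (e ord0) => //; exists x.
have /free /(_ ord0) /eqP : forall x, x \in `[0, 1] ->
    \sum_(k < d.+1) (k == ord0)%:R * e k x = 0.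
  move=> x xI; rewrite big1// => k _; have [->|_] := eqVneq k ord0; last by rewrite mul0r.
  have [->|ex] := eqVneq (e ord0 x) 0; first by rewrite mulr0.
  by case: ne; exists x.
by rewrite eqxx oner_eq0.
Qed.

Theorem theorem4 (R : realType) (q : R -> R) (t : R)
    (lambda0 : R) (lambda : int -> R) (n0 : nat)
    (hq : L1_01 q)
    (ht : 0 <= t < 2 * pi)
    (hlambda0 : first_eigenvalue_L q t lambda0)
    (hlambda : eigenvalue_labelling q t lambda)
    (hn0 : (0 < n0)%N) :
  (0 <= t < pi ->
   t ^+ 2 <= lambda0 ->
   (forall n : int, n0%:Z < n -> lambda n = (2 * n%:~R * pi + t) ^+ 2) ->
   {ae @lebesgue_measure R, forall x, x \in `[0, 1] -> q x = 0})
  /\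
  (pi <= t < 2 * pi ->
   (2 * pi - t) ^+ 2 <= lambda0 ->
   (forall n : int, n0%:Z < n -> lambda n = (2 * n%:~R * pi + t) ^+ 2) ->
   {ae @lebesgue_measure R, forall x, x \in `[0, 1] -> q x = 0}).
Proof.
have [t0 _] := andP ht.
have main s : cos s = cos t -> s ^+ 2 <= lambda0 ->
    (forall n : int, n0%:Z < n -> lambda n = (2 * n%:~R * pi + t) ^+ 2) ->
    {ae @lebesgue_measure R, forall x, x \in `[0, 1] -> q x = 0}.
  move=> cst sl H; apply: (mean_zero_rigidity hq) => [g g1 F G c1 g01 aF|].
    apply: (twisted_form_ge0 hq cst _ G c1 g01 aF) => m ms em.
    by have := hlambda0.2 m em; lra.
  apply: (mean_eq0 hq t0 (n0 := n0)) => n nn0.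
  by rewrite -[n%:R]/(n%:~R) -H ?ltz_nat//; exact: labelled_eigenvalue.
split=> [_|_ H]; first exact: main.
apply: (main (2 * pi - t)) => //.
have -> : 2 * pi - t = - t + pi *+ 2 by rewrite -mulr_natl; ring.
by rewrite cosD2pi cosN.
Qed.
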